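(* For all $(u,v)\in U\setminus D$ and all Borel sets $B\subseteq[0,1]$, $$H(u,v;B)=\int_B h\Big(\frac{u+v}2,\frac{u-v}2,w\Big)\,dw .$$
   Context: Let $S=\partial[0,1]^2$ be the boundary of the unit square, $D=\{(x,y)\in[0,1]^2:x=y\}$ its diagonal, and $U=\{(x,y)\in[0,1]^2:x\ge y\}$. Let $W_t=(W^{(1)}_t,W^{(2)}_t)$ be standard Brownian motion in $\mathbb R^2$, and for measurable $A\subseteq\mathbb R^2$ let $\tau_A=\inf\{t\ge0:W_t\in A\}$. For $(u,v)\in[0,1]^2$ and Borel $B\subseteq[0,1]$, define $$H(u,v;B)=\mathbb P\big(\tau_D<\tau_S,\ W^{(1)}_{\tau_D}\in B\mid W_0=(u,v)\big).$$ For $n\in\mathbb N=\{1,2,\ldots\}$ let $s_n(x,y)=\sin(n\pi x)\sinh(n\pi y)$, and for $x,y\in(0,1)$, $z\in[0,1]$ define $$h(x,y,z)=\sum_{n\in\mathbb N}\frac{2\sin(n\pi(1-z))}{\sinh(n\pi)}\Big(s_n(x,y)+s_n(1-x,1-y)-s_n(y,x)-s_n(1-y,1-x)\Big),$$ a series that, for $x,y\in(0,1)$, converges absolutely, uniformly in $z\in[0,1]$. (For $(u,v)\in U\setminus D$ both $(u\pm v)/2$ lie in $(0,1)$.) *)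

(* Defs.v *)
From HB Require Import structures.
From mathcomp Require Import all_boot all_order all_algebra.
From mathcomp Require Import all_classical all_reals all_analysis.

Set Implicit Arguments.
Unset Strict Implicit.
Unset Printing Implicit Defensive.

Import Order.TTheory GRing.Theory Num.Theory.
Import numFieldNormedType.Exports.

Local Open Scope classical_set_scope.
Local Open Scope ring_scope.

Definition boundary (T : topologicalType) (A : set T) : set T :=
  closure A `\` interior A.

Section square.
Variable R : realType.

Definition unit_square : set (R * R) := `[0, 1] `*` `[0, 1].

Definition sq_boundary : set (R * R) := boundary unit_square.

Definition sq_diag : set (R * R) := unit_square `&` [set p | p.1 = p.2].

Definition sq_lower : set (R * R) := unit_square `&` [set p | p.2 <= p.1].

End square.

Arguments sq_boundary R : clear implicits.
Arguments sq_diag R : clear implicits.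
Arguments sq_lower R : clear implicits.

Section brownian_motion.
Context (R : realType) (d : measure_display) (Omega : measurableType d)
  (P : probability Omega R).

(* The product rule over the whole family covers subfamilies: take A i = setT
   for the indices left out. *)
Definition independent_variables (d' : measure_display)
    (E : measurableType d') (n : nat) (X : 'I_n -> Omega -> E) : Prop :=
  forall A : 'I_n -> set E, (forall i, measurable (A i)) ->
    P (\bigcap_(i in [set: 'I_n]) (X i @^-1` A i)) =
    (\prod_(i < n) P (X i @^-1` A i))%E.

(* Standard planar Brownian motion started at p, with surely continuous paths.
   The second parameter of normal_prob is the standard deviation, so increments
   over [s, t] have law N(0, (t - s) I_2). *)
Record brownian_motion (p : R * R) (W : R -> Omega -> R * R) : Prop := {
  bm_measurable : forall t, 0 <= t -> measurable_fun setT (W t) ;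
  bm_start : forall w, W 0 w = p ;
  bm_continuous : forall w, {within `[0, +oo[, continuous (W ^~ w)} ;
  bm_independent : forall (n : nat) (t : nat -> R), 0 <= t 0%N ->
    (forall i, t i <= t i.+1) ->
    independent_variables
      (fun (i : 'I_n) (w : Omega) => W (t i.+1) w - W (t i) w) ;
  bm_gaussian : forall s t, 0 <= s -> s < t ->
    forall A : set (R * R), measurable A ->
    P [set w | A (W t w - W s w)] =
    (normal_prob 0 (Num.sqrt (t - s)) \x normal_prob 0 (Num.sqrt (t - s)))%E A
}.

(* Equal to +oo when the path never meets A (ereal_inf set0 = +oo). *)
Definition hitting_time (W : R -> Omega -> R * R) (A : set (R * R))
    (w : Omega) : \bar R :=
  ereal_inf [set t%:E | t in [set t | 0 <= t /\ A (W t w)]].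

(* The truncation by fine is harmless: the hitting time of the diagonal is
   finite on the event considered. *)
Definition diag_hit_prob (W : R -> Omega -> R * R) (B : set R) : \bar R :=
  P [set w | (hitting_time W (sq_diag R) w <
              hitting_time W (sq_boundary R) w)%E /\
             B (W (fine (hitting_time W (sq_diag R) w)) w).1].

End brownian_motion.

Section density.
Variable R : realType.

Definition sinh (x : R) : R := (expR x - expR (- x)) / 2.

Definition s_fun (n : nat) (x y : R) : R :=
  sin (n%:R * pi * x) * sinh (n%:R * pi * y).

Definition h_term (x y z : R) (n : nat) : R :=
  2 * sin (n%:R * pi * (1 - z)) / sinh (n%:R * pi) *
  (s_fun n x y + s_fun n (1 - x) (1 - y) - s_fun n y x
   - s_fun n (1 - y) (1 - x)).

Definition h_fun (x y z : R) : R :=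
  limn (fun N : nat => \sum_(1 <= n < N) h_term x y z n).

End density.

(* Main.v *)
(** Let [g_n (u, v)] be the combination of four [s_n]'s appearing in [h],
    evaluated at [x = (u + v) / 2], [y = (u - v) / 2]. It is an entire harmonic
    function that vanishes on the two legs of the triangle [U] and equals
    [sin (n pi (1 - x)) sinh (n pi)] on the diagonal. Optional stopping at the
    exit time of the triangle therefore gives the integral of
    [sin (n pi (1 - w))] against [H (u, v; dw)] as [g_n (u, v) / sinh (n pi)],
    which by orthogonality is also its integral against [h dw]. Sine moments
    determine a finite signed measure on (0, 1), so the two agree.

    Optional stopping needs no stochastic calculus: on a time grid of mesh
    delta, averaging the increment over its four rotations by a right angle
    leaves its Gaussian law unchanged, and the mean-value defect of [g_n] on
    these four points is cubic in the increment. Each step then costs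
    [O (delta ^ (3/2))], which is negligible after [O (1 / delta)] steps. The
    walk is stopped when it comes within [1 / (m + 1)] of the complement of the
    triangle; letting first delta go to 0 and then m to infinity recovers the
    exit time without any boundary regularity argument.

    Indicators are bounded limits of sine sums because iterating
    [x (3 - x ^ 2) / 2] on [-1, 1] converges to the sign, and the iterates of
    [sin] stay in the span of the sines. *)
Require Import Defs.
From HB Require Import structures.
From mathcomp Require Import all_boot all_order all_algebra.
From mathcomp Require Import all_classical all_reals all_analysis.
From mathcomp Require Import measurable_realfun.
From mathcomp Require Import ring lra.
Import Order.TTheory GRing.Theory Num.Theory.
Import numFieldNormedType.Exports.
Local Open Scope classical_set_scope.
Local Open Scope ring_scope.
Set Implicit Arguments.
Unset Strict Implicit.
Unset Printing Implicit Defensive.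

(** * Bounded convergence *)

(** The positive level matters because the set of points closer than $1/(m+1)$ to the complement of
    the triangle is open: a path inside it at one time is inside it at nearby times, so a fine grid
    cannot miss the visit. A path could touch the boundary itself between two grid points. The
    passage from level to boundary then only uses that a continuous positive function on a compact
    time interval has a positive minimum.

    The walk overshoots its level, possibly out of the triangle. The mean-value estimate must
    therefore hold for base points in the triangle but for increments of any size.

    Exits through a corner need no separate probability estimate: on the legs $g_n$ vanishes, and at
    the two ends of the diagonal the sines vanish, so every moment only sees the open diagonal.

    Nonnegativity of $h$ is not visible from its series. A starting point off the diagonal makes the
    coefficients decay geometrically, so $h$ is bounded, and the comparison of laws is run with a
    bounded signed density. *)

Section bounded_convergence.
Context (R : realType) (d : measure_display) (T : measurableType d)
  (mu : {measure set T -> \bar R}) (D : set T).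
Hypotheses (mD : measurable D) (muD : (mu D < +oo)%E).

Lemma bounded_integrable_on (f : T -> R) (M : R) :
  measurable_fun D f -> (forall x, D x -> `|f x| <= M) ->
  mu.-integrable D (EFin \o f).
Proof.
move=> mf fM; apply: measurable_bounded_integrable => //.
exists M; split; first exact: num_real.
by move=> r Mr x Dx; exact: le_trans (fM _ Dx) (ltW Mr).
Qed.

Lemma bounded_cvg_Rintegral (f_ : nat -> T -> R) (f : T -> R) (M : R) :
  (forall n, measurable_fun D (f_ n)) ->
  (forall n x, D x -> `|f_ n x| <= M) ->
  (forall x, D x -> f_ n x @[n --> \oo] --> f x) ->
  \int[mu]_(x in D) f_ n x @[n --> \oo] --> \int[mu]_(x in D) f x.
Proof.
move=> mf fM ff.
have fin : (\int[mu]_(x in D) (f x)%:E)%E \is a fin_num.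
  apply: integrable_fin_num => //; apply: (@bounded_integrable_on f M).
    exact: (measurable_fun_cvg mf ff).
  move=> x Dx; apply: (ler_cvg_to (cvg_norm (ff x Dx)) (cvg_cst M)).
  by apply: nearW => n; exact: fM.
apply: fine_cvg; rewrite fineK//.
apply: (@dominated_cvg _ _ _ _ _ mD _ _ (fun _ => M%:E)) => //.
- by move=> n; exact/measurable_EFinP.
- by move=> x Dx; apply: cvg_EFin; [exact: nearW|exact: ff].
- exact: (@bounded_integrable_on (fun _ => M) `|M|).
Qed.

End bounded_convergence.

(** * Four-point estimate for the harmonic functions *)

Section four_point.
Variable R : realType.
Implicit Types x y p q t u : R.

Definition cosh x : R := (expR x + expR (- x)) / 2.

(** One rung of a Taylor ladder: the mean value theorem raises the order of vanishing at 0 by one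
    and keeps the constant, giving up the factorials. *)
Lemma MVT_pow_bound (f df : R -> R) (K : R) n x :
  (forall t : R, is_derive t (1 : R) f (df t)) -> f 0 = 0 ->
  (forall t, `|t| <= 1 -> `|df t| <= K * `|t| ^+ n) -> `|x| <= 1 ->
  `|f x| <= K * `|x| ^+ n.+1.
Proof.
move=> fdf f0 dfK x1.
have cf a b : {within `[a, b], continuous f}.
  apply: continuous_subspaceT => t.
  exact/differentiable_continuous/derivable1_diffP.
have step (c : R) : f x = df c * x -> `|c| <= `|x| -> `|f x| <= K * `|x| ^+ n.+1.
  move=> -> cx; rewrite normrM exprSr mulrA ler_wpM2r//.
  apply: (le_trans (dfK _ (le_trans cx x1))).
  rewrite ler_wpM2l//; last by rewrite lerXn2r// nnegrE.
  (* The hypothesis at $t = 1$ yields $0 \le K$. *)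
  have /= := le_trans (normr_ge0 _) (dfK 1 _); rewrite normr1 expr1n mulr1.
  exact.
have [x0|x0] := leP 0 x.
  have [c] := MVT_segment x0 (fun t _ => fdf t) (cf _ _).
  rewrite in_itv/= f0 !subr0 => /andP[c0 cx] fE; apply: (step c) => //.
  by rewrite !ger0_norm.
have [c] := MVT_segment (ltW x0) (fun t _ => fdf t) (cf _ _).
rewrite in_itv/= f0 !sub0r => /andP[xc c0] fE; apply: (step c).
  by apply: oppr_inj; rewrite fE mulrN.
by rewrite !ler0_norm ?lerN2// ltW.
Qed.

Lemma sin_cos_taylor x : `|x| <= 1 ->
  `|sin x - x| <= `|x| ^+ 3 /\ `|cos x - 1 + x ^+ 2 / 2| <= `|x| ^+ 3.
Proof.
have s1 t : `|t| <= 1 -> `|sin t| <= 1 * `|t| ^+ 1.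
  apply: (@MVT_pow_bound sin cos 1 0); last by move=> ? _; rewrite expr0 mulr1 cos_max.
  exact: sin0.
have c2 t : `|t| <= 1 -> `|cos t - 1| <= 1 * `|t| ^+ 2.
  apply: (@MVT_pow_bound (fun t => cos t - 1) (fun t => - sin t) 1 1).
  - by move=> u; apply: is_derive_eq; rewrite subr0.
  - by rewrite cos0 subrr.
  - by move=> u /s1; rewrite normrN.
have s3 t : `|t| <= 1 -> `|sin t - t| <= 1 * `|t| ^+ 3.
  apply: (@MVT_pow_bound (fun t => sin t - t) (fun t => cos t - 1) 1 2) => //.
  by rewrite sin0 subrr.
move=> x1; split; first by have := s3 _ x1; rewrite mul1r.
have : `|cos x - 1 + x ^+ 2 / 2| <= 1 * `|x| ^+ 4.
  apply: (@MVT_pow_bound (fun t => cos t - 1 + t ^+ 2 / 2)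
    (fun t => - sin t + t) 1 3) => //.
  - by move=> u; apply: is_derive_eq; rewrite subr0 scaler1 /GRing.scale/=; field.
  - by rewrite cos0 expr0n/= mul0r addr0 subrr.
  - by move=> u /s3; rewrite -normrN opprB addrC.
rewrite mul1r => /le_trans; apply.
by rewrite exprS ler_piMl// exprn_ge0.
Qed.

Lemma expR_taylor x : `|x| <= 1 ->
  `|expR x - 1 - x - x ^+ 2 / 2| <= 3 * `|x| ^+ 3.
Proof.
have e0 t : `|t| <= 1 -> `|expR t| <= 3 * `|t| ^+ 0.
  move=> t1; rewrite expr0 mulr1 ger0_norm ?expR_ge0//.
  have /le_trans : expR t <= expR 1.
    by rewrite ler_expR (le_trans (ler_norm _)).
  apply; have := @expR_ge1Dx R (- 2^-1); rewrite expRN => h.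
  have e12 : expR (2^-1 : R) <= 2.
    have : (expR (2^-1 : R))^-1 * expR 2^-1 = 1 by rewrite mulVf// gt_eqF ?expR_gt0.
    by have := expR_gt0 (2^-1:R); nra.
  have h4 := @expR_ge1Dx R (- 4^-1); rewrite expRN in h4.
  have h8 := @expR_ge1Dx R (- 8^-1); rewrite expRN in h8.
  (* From $e^{-1/8} \ge 7/8$; the bound $e \le 3$ then follows from $(8/7)^8 < 3$. *)
  have e8 : expR (8^-1 : R) <= 8 / 7.
    have : (expR (8^-1 : R))^-1 * expR 8^-1 = 1 by rewrite mulVf// gt_eqF ?expR_gt0.
    by have := expR_gt0 (8^-1:R); nra.
  have -> : expR 1 = expR (8^-1 : R) ^+ 8.
    by rewrite -expRM_natl; congr expR; field.
  apply: (@le_trans _ _ ((8 / 7) ^+ 8)).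
    by rewrite lerXn2r// ?nnegrE ?expR_ge0//; lra.
  by lra.
have e1 t : `|t| <= 1 -> `|expR t - 1| <= 3 * `|t| ^+ 1.
  apply: (@MVT_pow_bound (fun t => expR t - 1) expR 3 0) => //.
  - by move=> u; apply: is_derive_eq; rewrite subr0.
  - by rewrite expR0 subrr.
have e2 t : `|t| <= 1 -> `|expR t - 1 - t| <= 3 * `|t| ^+ 2.
  apply: (@MVT_pow_bound (fun t => expR t - 1 - t) (fun t => expR t - 1) 3 1) => //.
  - by move=> u; apply: is_derive_eq; rewrite subr0.
  - by rewrite expR0 subrr subr0.
apply: (@MVT_pow_bound (fun t => expR t - 1 - t - t ^+ 2 / 2)
   (fun t => expR t - 1 - t) 3 2) => //.
- by move=> u; apply: is_derive_eq; rewrite subr0 scaler1 /GRing.scale/=; field.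
- by rewrite expR0 subrr expr0n/= mul0r !subr0.
Qed.

Lemma sinh_cosh_taylor x : `|x| <= 1 ->
  `|sinh x - x| <= 3 * `|x| ^+ 3 /\ `|cosh x - 1 - x ^+ 2 / 2| <= 3 * `|x| ^+ 3.
Proof.
move=> x1; have h1 := expR_taylor x1.
have := @expR_taylor (- x); rewrite normrN => /(_ x1) h2.
rewrite sqrrN in h2; move: h1 h2; rewrite /sinh /cosh !ler_norml.
by move=> /andP[? ?] /andP[? ?]; split; apply/andP; split; lra.
Qed.

Lemma sinhD x y : sinh (x + y) = sinh x * cosh y + cosh x * sinh y.
Proof. by rewrite /sinh /cosh opprD !expRD; field. Qed.

Lemma sinhN x : sinh (- x) = - sinh x.
Proof. by rewrite /sinh opprK; field. Qed.

Lemma coshN x : cosh (- x) = cosh x.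
Proof. by rewrite /cosh opprK addrC. Qed.

Lemma sinh_cosh_norm_le x K : `|x| <= K ->
  `|sinh x| <= expR K /\ `|cosh x| <= expR K.
Proof.
rewrite ler_norml => /andP[xK Kx].
have e1 : 0 < expR x <= expR K by rewrite expR_gt0 ler_expR.
have e2 : 0 < expR (- x) <= expR K by rewrite expR_gt0 ler_expR lerNl.
by rewrite /sinh /cosh; split; rewrite ler_norml; apply/andP; split; lra.
Qed.

(* The bound is cubic in the larger of |p| and |q|: the quadratic terms cancel
   because sin (x) sinh (y) is harmonic. *)
Lemma four_point_small p q : `|p| <= 1 -> `|q| <= 1 ->
  `|cos p * cosh q + cos q * cosh p - 2| <= 100 * (`|p| ^+ 3 + `|q| ^+ 3) /\
  `|sin p * sinh q - sin q * sinh p| <= 100 * (`|p| ^+ 3 + `|q| ^+ 3).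
Proof.
move=> p1 q1.
have [sp cp] := sin_cos_taylor p1; have [sq cq] := sin_cos_taylor q1.
have [shp chp] := sinh_cosh_taylor p1; have [shq chq] := sinh_cosh_taylor q1.
(* Every error is compared with $m^3$; since $m \le 1$, fourth-order terms are absorbed as well. *)
set m := Num.max `|p| `|q|.
have m0 : 0 <= m by rewrite le_max normr_ge0.
have m1 : m <= 1 by rewrite ge_max p1 q1.
have pm : `|p| <= m by rewrite le_max lexx.
have qm : `|q| <= m by rewrite le_max lexx orbT.
have p3 : `|p| ^+ 3 <= m ^+ 3 by rewrite lerXn2r// nnegrE.
have q3 : `|q| ^+ 3 <= m ^+ 3 by rewrite lerXn2r// nnegrE.
have m3 : m ^+ 3 <= `|p| ^+ 3 + `|q| ^+ 3.
  by rewrite /m /Num.max; case: ifP => _; rewrite ?lerDl ?lerDr exprn_ge0.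
suff [h1 h2] : `|cos p * cosh q + cos q * cosh p - 2| <= 100 * m ^+ 3 /\
  `|sin p * sinh q - sin q * sinh p| <= 100 * m ^+ 3.
  by split; [apply: (le_trans h1)|apply: (le_trans h2)]; rewrite ler_wpM2l.
have m30 : 0 <= m ^+ 3 by rewrite exprn_ge0.
have m3m : m ^+ 3 <= m by rewrite exprS ler_piMr// exprn_ile1.
have m2 : m ^+ 2 * m ^+ 2 <= m ^+ 3.
  by rewrite -exprD [X in X <= _]exprS ler_piMl.
have p2m : p ^+ 2 <= m ^+ 2.
  by rewrite -(ger0_norm (sqr_ge0 p)) normrX lerXn2r// nnegrE.
have q2m : q ^+ 2 <= m ^+ 2.
  by rewrite -(ger0_norm (sqr_ge0 q)) normrX lerXn2r// nnegrE.
have pq2 : p ^+ 2 * q ^+ 2 <= m ^+ 3.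
  by apply: le_trans m2; rewrite ler_pM// sqr_ge0.
have cM (x y r s : R) : `|x| <= r -> `|y| <= s -> `|x * y| <= r * s.
  by move=> xr ys; rewrite normrM ler_pM.
have bnd (a e k : R) : `|e| <= k -> `|a - e| <= k -> `|a| <= k + k.
  by move=> h1 h2; rewrite -(subrK e a); apply: (le_trans (ler_normD _ _)); rewrite lerD.
set rcp := cos p - 1 + p ^+ 2 / 2 in cp.
set rcq := cos q - 1 + q ^+ 2 / 2 in cq.
set rhp := cosh p - 1 - p ^+ 2 / 2 in chp.
set rhq := cosh q - 1 - q ^+ 2 / 2 in chq.
set rsp := sin p - p in sp.
set rsq := sin q - q in sq.
set tp := sinh p - p in shp.
set tq := sinh q - q in shq.
have m21 : m ^+ 2 <= 1 by rewrite exprn_ile1.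
have chp4 : `|cosh p| <= 5.
  have -> : cosh p = rhp + (1 + p ^+ 2 / 2) by rewrite /rhp; ring.
  apply: (le_trans (ler_normD _ _)); rewrite [X in _ + X]ger0_norm; last first.
    by rewrite addr_ge0// divr_ge0// sqr_ge0.
  by have := le_trans chp (ler_wpM2l _ p3); lra.
have chq4 : `|cosh q| <= 5.
  have -> : cosh q = rhq + (1 + q ^+ 2 / 2) by rewrite /rhq; ring.
  apply: (le_trans (ler_normD _ _)); rewrite [X in _ + X]ger0_norm; last first.
    by rewrite addr_ge0// divr_ge0// sqr_ge0.
  by have := le_trans chq (ler_wpM2l _ q3); lra.
have shp4 : `|sinh p| <= 4.
  have -> : sinh p = tp + p by rewrite /tp; ring.
  apply: (le_trans (ler_normD _ _)).
  by have := le_trans shp (ler_wpM2l _ p3); lra.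
have shq4 : `|sinh q| <= 4.
  have -> : sinh q = tq + q by rewrite /tq; ring.
  apply: (le_trans (ler_normD _ _)).
  by have := le_trans shq (ler_wpM2l _ q3); lra.
have lp : `|1 - p ^+ 2 / 2| <= 1.
  by rewrite ler_norml; apply/andP; have := sqr_ge0 p; split; lra.
have lq : `|1 - q ^+ 2 / 2| <= 1.
  by rewrite ler_norml; apply/andP; have := sqr_ge0 q; split; lra.
have cp' := le_trans cp p3; have cq' := le_trans cq q3.
have sp' := le_trans sp p3; have sq' := le_trans sq q3.
have h3 (x : R) (a b : R) : a <= 3 * b -> b <= x -> a <= 3 * x.
  by move=> ? ?; lra.
have chp' := h3 _ _ _ chp p3; have chq' := h3 _ _ _ chq q3.
have shp' := h3 _ _ _ shp p3; have shq' := h3 _ _ _ shq q3.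
split.
  (* The polynomial parts $(1-p^2/2)(1+q^2/2) + (1-q^2/2)(1+p^2/2) - 2$ collapse to $-p^2q^2/2$;
     every other term carries a Taylor remainder. *)
  have -> : cos p * cosh q + cos q * cosh p - 2 =
      rcp * cosh q + (1 - p ^+ 2 / 2) * rhq + (rcq * cosh p +
      (1 - q ^+ 2 / 2) * rhp) - p ^+ 2 * q ^+ 2 / 2.
    by rewrite /rcp /rhp /rcq /rhq; field.
  have := cM _ _ _ _ cp' chq4; have := cM _ _ _ _ lp chq'.
  have := cM _ _ _ _ cq' chp4; have := cM _ _ _ _ lq chp'.
  have := sqr_ge0 (p * q); rewrite exprMn !ler_norml => ?.
  move=> /andP[? ?] /andP[? ?] /andP[? ?] /andP[? ?].
  by apply/andP; split; lra.
have -> : sin p * sinh q - sin q * sinh p =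
    rsp * sinh q + p * tq - (rsq * sinh p + q * tp).
  by rewrite /rsp /rsq /tp /tq; ring.
have := cM _ _ _ _ sp' shq4; have := cM _ _ _ _ p1 shq'.
have := cM _ _ _ _ sq' shp4; have := cM _ _ _ _ q1 shp'.
rewrite !ler_norml => /andP[? ?] /andP[? ?] /andP[? ?] /andP[? ?].
by apply/andP; split; lra.
Qed.

Definition clamp (M x : R) : R := Num.max (- M) (Num.min M x).

Lemma clamp_id M x : `|x| <= M -> clamp M x = x.
Proof.
rewrite ler_norml /clamp => /andP[Mx xM].
by rewrite (min_idPr xM) (max_idPr Mx).
Qed.

Lemma clamp_norm_le M x : 0 <= M -> `|clamp M x| <= M.
Proof.
move=> M0; rewrite ler_norml /clamp le_max lexx/= ge_max ge_min lexx/=.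
by rewrite andbT; lra.
Qed.

(* Clamping makes the harmonic function bounded, which is what dominates the
   overshoot of the grid walk; the bound is large enough to be invisible within
   distance 1 / k of the unit interval. *)
Definition sin_clamp_sinh (k x y : R) : R :=
  sin (k * x) * clamp (expR (k + 1)) (sinh (k * y)).

Lemma sin_clamp_sinh_le k x y : `|sin_clamp_sinh k x y| <= expR (k + 1).
Proof.
by rewrite normrM -[leRHS]mul1r ler_pM// ?sin_max// clamp_norm_le//.
Qed.

Lemma sin_clamp_sinhE k x y : 0 <= k -> 0 <= y <= 1 ->
  sin_clamp_sinh k x y = sin (k * x) * sinh (k * y).
Proof.
move=> k0 /andP[y0 y1]; rewrite /sin_clamp_sinh clamp_id//.
apply: (sinh_cosh_norm_le _).1.
rewrite ger0_norm ?mulr_ge0//.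
by rewrite (le_trans (ler_piMr k0 y1))// lerDl.
Qed.

(** For small increments the clamps are inactive, and the addition formulas write the defect through
    the two expressions of [four_point_small]. For large ones the cubic right-hand side already
    exceeds the crude bound $8M$ on five bounded terms. *)
Lemma sin_clamp_sinh_four_point k : 0 < k -> exists C : R, 0 <= C /\
  forall x y p q, 0 <= y <= 1 ->
  `|sin_clamp_sinh k (x + p) (y + q) + sin_clamp_sinh k (x - p) (y - q) +
    sin_clamp_sinh k (x + q) (y - p) + sin_clamp_sinh k (x - q) (y + p) -
    4 * sin_clamp_sinh k x y| <= C * (`|p| ^+ 3 + `|q| ^+ 3).
Proof.
move=> k0; set M := expR (k + 1).
have M0 : 0 < M by exact: expR_gt0.
exists (400 * M * k ^+ 3); split.
  by rewrite !mulr_ge0// ?exprn_ge0// ltW.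
move=> x y p q /[dup] y01 /andP[y0 y1].
have E3 : 400 * M * k ^+ 3 * (`|p| ^+ 3 + `|q| ^+ 3) =
    4 * M * (100 * (`|k * p| ^+ 3 + `|k * q| ^+ 3)).
  by rewrite !normrM !(gtr0_norm k0) !exprMn; ring.
rewrite E3.
have [/andP[kp kq]|] := boolP ((`|k * p| <= 1) && (`|k * q| <= 1)).
  have ky : `|k * y| <= k.
    by rewrite ger0_norm ?mulr_ge0// ?(ltW k0)// ler_piMr// ltW.
  have kyM t : `|k * t| <= 1 -> `|k * (y + t)| <= k + 1.
    by move=> kt; rewrite mulrDr (le_trans (ler_normD _ _))// lerD.
  have E x' t : `|k * t| <= 1 ->
      sin_clamp_sinh k x' (y + t) = sin (k * x') * sinh (k * y + k * t).
    move=> kt; rewrite /sin_clamp_sinh clamp_id ?mulrDr//.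
    by apply: (sinh_cosh_norm_le _).1; rewrite -mulrDr kyM.
  rewrite !E ?mulrN ?normrN//.
  rewrite (@sin_clamp_sinhE k x y (ltW k0))//.
  have [h1 h2] := four_point_small kp kq.
  set S := 100 * (`|k * p| ^+ 3 + `|k * q| ^+ 3) in h1 h2 *.
  rewrite ![k * (_ + _)]mulrDr !mulrN !sinD !sinhD !sinN !cosN !sinhN !coshN.
  have kyk1 : `|k * y| <= k + 1 by rewrite (le_trans ky)// lerDl.
  have [sM cM] := sinh_cosh_norm_le kyk1.
  set A := k * x; set B := k * y in sM cM *.
  set P := k * p in h1 h2 *; set Q := k * q in h1 h2 *.
  set E1 := cos P * cosh Q + cos Q * cosh P - 2 in h1.
  set E2 := sin P * sinh Q - sin Q * sinh P in h2.
  rewrite [X in `|X|](_ : _ = 2 * (sin A * sinh B * E1) + 2 * (cos A * cosh B * E2));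
    last by rewrite /E1 /E2; ring.
  have f1 : `|sin A * sinh B * E1| <= 1 * M * S.
    rewrite normrM; apply: ler_pM => //; rewrite normrM; apply: ler_pM => //.
    exact: sin_max.
  have f2 : `|cos A * cosh B * E2| <= 1 * M * S.
    rewrite normrM; apply: ler_pM => //; rewrite normrM; apply: ler_pM => //.
    exact: cos_max.
  have gen (X Y N : R) : `|X| <= N -> `|Y| <= N -> `|2 * X + 2 * Y| <= 4 * N.
    rewrite !ler_norml => /andP[? ?] /andP[? ?].
    by apply/andP; split; lra.
  by rewrite -(mulrA 4 M); apply: gen; rewrite -[M]mul1r.
rewrite negb_and -!ltNge => big.
have S1 : 1 <= `|k * p| ^+ 3 + `|k * q| ^+ 3.
  have e1 (t : R) : 1 < `|t| -> 1 <= `|t| ^+ 3 by move=> /ltW t1; exact: exprn_ege1.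
  by case/orP: big => /e1 h; rewrite (le_trans h)// ?lerDl ?lerDr exprn_ge0.
apply: (@le_trans _ _ (8 * M)).
  have := sin_clamp_sinh_le k (x + p) (y + q).
  have := sin_clamp_sinh_le k (x - p) (y - q).
  have := sin_clamp_sinh_le k (x + q) (y - p).
  have := sin_clamp_sinh_le k (x - q) (y + p).
  have := sin_clamp_sinh_le k x y.
  rewrite -/M !ler_norml => /andP[? ?] /andP[? ?] /andP[? ?] /andP[? ?] /andP[? ?].
  by apply/andP; split; lra.
by have := ler_wpM2l (ltW M0) S1; nra.
Qed.

(* For k = n pi, the n-th term of h without its factor depending on z; on the
   triangle the clamps are inactive. *)
Definition bracket (k : R) (a : R * R) : R :=
  let x := (a.1 + a.2) / 2 in let y := (a.1 - a.2) / 2 in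
  sin_clamp_sinh k x y + sin_clamp_sinh k (1 - x) (1 - y)
  - sin_clamp_sinh k y x - sin_clamp_sinh k (1 - y) (1 - x).

Definition triangle : set (R * R) :=
  [set a | [/\ 0 <= a.2, a.1 <= 1 & a.2 <= a.1]].

Definition rot90 (a : R * R) : R * R := (- a.2, a.1).

Lemma bracket_norm_le k a : `|bracket k a| <= 4 * expR (k + 1).
Proof.
rewrite /bracket/=; set x := (_ / 2); set y := (_ / 2).
have := sin_clamp_sinh_le k x y; have := sin_clamp_sinh_le k (1 - x) (1 - y).
have := sin_clamp_sinh_le k y x; have := sin_clamp_sinh_le k (1 - y) (1 - x).
rewrite !ler_norml => /andP[? ?] /andP[? ?] /andP[? ?] /andP[? ?].
by apply/andP; split; lra.
Qed.

(** In the coordinates $x = (u+v)/2$, $y = (u-v)/2$ a quarter turn of [h] is the quarter turn $(p,q)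
    \mapsto (q,-p)$, so each of the four summands falls under the previous estimate. The factor 4
    counts the summands; the factor 2 comes from $|p|, |q| \le \max(|h_1|,|h_2|)$. *)
Lemma bracket_four_point k : 0 < k -> exists C : R, 0 <= C /\
  forall a h, triangle a ->
  `|bracket k (a + h) + bracket k (a + rot90 h) + bracket k (a + rot90 (rot90 h)) +
    bracket k (a + rot90 (rot90 (rot90 h))) - 4 * bracket k a| <=
  C * (`|h.1| ^+ 3 + `|h.2| ^+ 3).
Proof.
move=> /sin_clamp_sinh_four_point[C [C0 HC]].
exists (4 * C * 2); split; first by rewrite !mulr_ge0.
move=> [u v] [h1 h2] [/= v0 u1 vu].
rewrite /bracket/= !opprK.
pose x := (u + v) / 2; pose y := (u - v) / 2.
pose p := (h1 + h2) / 2; pose q := (h1 - h2) / 2.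
have bp : `|p| <= Num.max `|h1| `|h2| /\ `|q| <= Num.max `|h1| `|h2|.
  have a1 : `|h1| <= Num.max `|h1| `|h2| by rewrite le_max lexx.
  have a2 : `|h2| <= Num.max `|h1| `|h2| by rewrite le_max lexx orbT.
  move: a1 a2; rewrite /p /q !ler_norml => /andP[? ?] /andP[? ?].
  by split; apply/andP; split; lra.
have S : `|p| ^+ 3 + `|q| ^+ 3 <= 2 * (`|h1| ^+ 3 + `|h2| ^+ 3).
  have mx : Num.max `|h1| `|h2| ^+ 3 <= `|h1| ^+ 3 + `|h2| ^+ 3.
    by rewrite /Num.max; case: ifP => _; rewrite ?lerDl ?lerDr exprn_ge0.
  have mx0 : 0 <= Num.max `|h1| `|h2| by rewrite le_max normr_ge0.
  rewrite mulr_natl mulr2n; apply: lerD; apply: le_trans mx;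
    rewrite lerXn2r// ?nnegrE//; by case: bp.
have x01 : 0 <= x <= 1 by rewrite /x; apply/andP; split; lra.
have y01 : 0 <= y <= 1 by rewrite /y; apply/andP; split; lra.
have x01' : 0 <= 1 - x <= 1 by apply/andP; split; lra.
have y01' : 0 <= 1 - y <= 1 by apply/andP; split; lra.
have A1 := HC x y p q y01.
have A2 := HC (1 - x) (1 - y) (- p) (- q) y01'.
have A3 := HC y x q p x01.
have A4 := HC (1 - y) (1 - x) (- q) (- p) x01'.
rewrite !normrN in A2 A4.
have e1 : (u + h1 + (v + h2)) / 2 = x + p by rewrite /x /p; field.
have e2 : (u + h1 - (v + h2)) / 2 = y + q by rewrite /y /q; field.
have e3 : (u - h2 + (v + h1)) / 2 = x + q by rewrite /x /q; field.
have e4 : (u - h2 - (v + h1)) / 2 = y - p by rewrite /y /p; field.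
have e5 : (u - h1 + (v - h2)) / 2 = x - p by rewrite /x /p; field.
have e6 : (u - h1 - (v - h2)) / 2 = y - q by rewrite /y /q; field.
have e7 : (u + h2 + (v - h1)) / 2 = x - q by rewrite /x /q; field.
have e8 : (u + h2 - (v - h1)) / 2 = y + p by rewrite /y /p; field.
rewrite e1 e2 e3 e4 e5 e6 e7 e8 -/x -/y.
have o1 a b : 1 - (a + b) = 1 - a + - b :> R by ring.
have o2 a b : 1 - (a - b) = 1 - a - - b :> R by ring.
rewrite !o2 !o1.
have {}A1 := le_trans A1 (ler_wpM2l C0 S).
have {}A2 := le_trans A2 (ler_wpM2l C0 S).
rewrite [X in C * X]addrC in A3; have {}A3 := le_trans A3 (ler_wpM2l C0 S).
rewrite [X in C * X]addrC in A4; have {}A4 := le_trans A4 (ler_wpM2l C0 S).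
move: A1 A2 A3 A4; rewrite !ler_norml.
move=> /andP[? ?] /andP[? ?] /andP[? ?] /andP[? ?].
by apply/andP; split; lra.
Qed.

End four_point.

(** * Gaussian increments *)

Section density.
Local Open Scope ereal_scope.
Context d (T : measurableType d) (R : realType).
Variables (nu mu : {measure set T -> \bar R}) (p : T -> R).
Hypotheses (p0 : forall x, (0 <= p x)%R) (mp : measurable_fun setT p).
Hypothesis nuE : forall A, measurable A -> nu A = \int[mu]_(x in A) (p x)%:E.

Import HBNNSimple.

(** [normal_prob] is given by its values on sets, while moments need the density under the integral
    of a function. The passage goes through simple functions and monotone convergence on both
    sides. *)
Lemma ge0_integral_density (f : T -> \bar R) :
  (forall x, 0 <= f x) -> measurable_fun setT f ->
  \int[nu]_x f x = \int[mu]_x (f x * (p x)%:E).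
Proof.
move=> f0 mf; pose h := nnsfun_approx measurableT mf.
have mpE : measurable_fun setT (EFin \o p) by exact/measurable_EFinP.
have cvh x : (EFin \o h n) x @[n --> \oo] --> f x.
  by apply: cvg_nnsfun_approx.
have -> : \int[nu]_x f x = lim (\int[nu]_x (EFin \o h n) x @[n --> \oo]).
  have fE x : f x = lim ((EFin \o h n) x @[n --> \oo]) by exact/esym/cvg_lim.
  under eq_integral do rewrite fE.
  apply: monotone_convergence => //.
  - by move=> n; apply/measurable_EFinP; exact/measurable_funP.
  - by move=> n x _; rewrite lee_fin.
  - by move=> x _ a b ab; rewrite lee_fin; exact/lefP/nd_nnsfun_approx.
have -> : \int[mu]_x (f x * (p x)%:E) =
    lim (\int[mu]_x ((EFin \o h n) x * (p x)%:E) @[n --> \oo]).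
  have fE x : f x * (p x)%:E = lim (((EFin \o h n) x * (p x)%:E) @[n --> \oo]).
    by apply/esym/cvg_lim => //; exact: cvgeZr.
  under eq_integral do rewrite fE.
  apply: monotone_convergence => //.
  - move=> n; apply: emeasurable_funM => //.
    by apply/measurable_EFinP; exact/measurable_funP.
  - by move=> n x _; rewrite mule_ge0 ?lee_fin.
  - move=> x _ a b ab; rewrite lee_wpmul2r ?lee_fin//.
    exact/lefP/nd_nnsfun_approx.
suff suf n : \int[mu]_x ((EFin \o h n) x * (p x)%:E) = \int[nu]_x (EFin \o h n) x.
  by under [in RHS]eq_fun do rewrite suf.
apply/esym.
have mh r : measurable (h n @^-1` [set r]) by [].
transitivity (\int[nu]_x (\sum_(y \in range (h n))
    (y * \1_(h n @^-1` [set y]) x)%:E)).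
  by apply: eq_integral => t _; rewrite /= fimfunE -fsumEFin.
transitivity (\int[mu]_x (\sum_(y \in range (h n))
    ((y * \1_(h n @^-1` [set y]) x)%:E * (p x)%:E))); last first.
  apply: eq_integral => x _.
  rewrite -ge0_mule_fsuml => [|y]; last exact: nnfun_muleindic_ge0.
  by rewrite fsumEFin// -(fimfunE _ x).
have mind r : measurable_fun setT (fun x => (r * \1_(h n @^-1` [set r]) x)%:E).
  by apply/measurable_EFinP; exact: measurable_funM.
rewrite ge0_integral_fsum//; last by move=> y x _; exact: nnfun_muleindic_ge0.
rewrite ge0_integral_fsum//; last 2 first.
  - by move=> y; exact: emeasurable_funM.
  - by move=> y x _; rewrite mule_ge0 ?lee_fin// -?lee_fin ?nnfun_muleindic_ge0.
apply: eq_fsbigr => r /[!inE] -[t _ <-].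
under [LHS]eq_integral do rewrite EFinM.
rewrite integralZl_indic_nnsfun// integral_indic// setIT.
under [RHS]eq_integral do rewrite EFinM -muleA.
rewrite ge0_integralZl//; last 3 first.
  - apply: emeasurable_funM => //; apply/measurable_EFinP; exact: measurable_indic.
  - by move=> x _; rewrite mule_ge0 ?lee_fin.
  - by rewrite lee_fin.
congr (_ * _); rewrite nuE// [LHS]integral_mkcond; apply: eq_integral => x _.
by rewrite patchE indicE; case: ifPn => _; rewrite ?mul1e ?mul0e.
Qed.

End density.

(** Bundles the pushforward as a measure, with the measurability proof as an explicit argument, so
    that uniqueness theorems for measures apply to it. *)
Definition measure_pushforward d d' (X : measurableType d) (Y : measurableType d')
    (R : realType) (m : {measure set X -> \bar R}) (f : X -> Y)
    (mf : measurable_fun setT f) : {measure set Y -> \bar R} :=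
  measure_function_pushforward__canonical__measure_function_Measure m mf.

Section gauss.
Variable R : realType.
Implicit Types s x : R.
Local Notation N s := (normal_prob (0 : R) s).
Local Notation TR := (measurableTypeR R).

Lemma normal_probN s (A : set R) : s != 0 -> measurable A ->
  N s (-%R @^-1` A) = N s A.
Proof.
move=> s0 mA; rewrite /normal_prob.
have mN : measurable_fun setT (-%R : R -> R) by exact: measurable_funN.
have mf : measurable_fun setT (EFin \o normal_pdf (0 : R) s).
  by apply/measurable_EFinP; exact: measurable_normal_pdf.
have -> : (\int[lebesgue_measure]_(x in A) (normal_pdf 0 s x)%:E =
   \int[pushforward lebesgue_measure (-%R : R -> measurableTypeR R)]_(x in A)
     (normal_pdf 0 s x)%:E)%E.
  by apply: eq_measure_integral => B mB _; rewrite -[LHS]lebesgue_measureN.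
rewrite ge0_integral_pushforward//; last 2 first.
  - exact: measurable_funTS.
  - by move=> x _; rewrite lee_fin normal_pdf_ge0.
apply: eq_integral => x _ /=.
by rewrite !normal_pdfE// /normal_fun !subr0 sqrrN.
Qed.

Lemma measurable_rot : measurable_fun setT (@rot90 R).
Proof.
apply: measurable_fun_pair => //; apply: measurable_funN.
exact: measurable_snd.
Qed.

(** A quarter turn carries rectangles to rectangles, exchanging the sides and reflecting one of
    them. Evenness of the one-dimensional law thus suffices on rectangles, and these determine the
    product measure. *)
Lemma normal2_rot s (A : set (R * R)) : s != 0 -> measurable A ->
  (N s \x N s)%E (@rot90 R @^-1` A) = (N s \x N s)%E A.
Proof.
move=> s0 mA; apply/esym.
have mrot : measurable_fun [set: TR * TR] (@rot90 R : TR * TR -> TR * TR).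
  exact: measurable_rot.
apply: (@product_measure_unique _ _ _ _ _ (N s) (N s)
  (measure_pushforward (N s \x N s)%E mrot)) => //.
move=> B C mB mC; rewrite /= /pushforward.
have -> : @rot90 R @^-1` (B `*` C) = C `*` (-%R @^-1` B).
  by apply/seteqP; split => -[x y] /= [].
have mNB : measurable (-%R @^-1` B : set R).
  by rewrite -[_ @^-1` _]setTI; exact: (measurable_funN (@measurable_id _ _ setT)).
by rewrite product_measure1E// muleC; congr (_ * _)%E; exact: normal_probN.
Qed.

Lemma normal_peak2 s : normal_peak (2 * s) = normal_peak s / 2.
Proof.
rewrite /normal_peak exprMn -mulrA -mulrnAr sqrtrM ?sqr_ge0//.
by rewrite sqrtr_sqr ger0_norm// invfM mulrC.
Qed.

(** The right-hand side is a Gaussian profile of doubled standard deviation. The spare factor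
    $e^{-3y^2/8}$ is split into two equal factors, each controlled by $1 + t \le e^t$, which leaves
    $y^3 \le 15(1 + 3y^2/16)^2$. *)
Lemma cube_gauss_le (y : R) : 0 <= y ->
  y ^+ 3 * expR (- (y ^+ 2 / 2)) <= 15 * expR (- (y ^+ 2 / 8)).
Proof.
move=> y0; have -> : - (y ^+ 2 / 2) = - (y ^+ 2 / 8) - (3 / 16 * y ^+ 2 + 3 / 16 * y ^+ 2) by field.
rewrite expRD mulrCA mulrC ler_wpM2r ?expR_ge0//.
rewrite expRN ler_pdivrMr ?expR_gt0// expRD.
have := @expR_ge1Dx R (3 / 16 * y ^+ 2).
set e := expR _ => h.
have h2 : (1 + 3 / 16 * y ^+ 2) ^+ 2 <= e * e.
  by rewrite -expr2 lerXn2r// nnegrE ?expR_ge0// addr_ge0// mulr_ge0// sqr_ge0.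
apply: le_trans (ler_wpM2l _ h2) => //.
have := sqr_ge0 (y * (y - 1)); have := sqr_ge0 y; have := sqr_ge0 (y ^+ 2).
by nra.
Qed.

(** The integrand is dominated by a multiple of the density of standard deviation $2s$, whose
    integral is 1. The constant is $30 = 2 \cdot 15$, the 2 being the ratio of the peaks; only the
    order $s^3$ matters later. *)
Lemma normal_third_moment s : 0 < s ->
  (\int[N s]_x (`|x| ^+ 3)%:E <= (30 * s ^+ 3)%:E)%E.
Proof.
move=> s0; have s_neq0 : s != 0 by rewrite gt_eqF.
have s2_neq0 : 2 * s != 0 by rewrite mulf_neq0.
have m3 : measurable_fun setT (fun x : R => (`|x| ^+ 3)%:E).
  by apply/measurable_EFinP; apply: measurable_funX; exact: normr_measurable.
have mpdf r : measurable_fun setT (normal_pdf 0 r : TR -> R).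
  exact: measurable_normal_pdf.
rewrite (ge0_integral_density (p := normal_pdf 0 s) (mu := lebesgue_measure)
  (normal_pdf_ge0 0 s) (mpdf s))//.
apply: (@le_trans _ _
  (\int[lebesgue_measure]_x ((30 * s ^+ 3)%:E * (normal_pdf 0 (2 * s) x)%:E))%E).
  apply: ge0_le_integral => //=.
  - by move=> x _; rewrite mule_ge0// lee_fin ?exprn_ge0 ?normal_pdf_ge0.
  - apply: emeasurable_funM => //.
    by apply/measurable_EFinP; exact: measurable_normal_pdf.
  - apply: emeasurable_funM => //.
    by apply/measurable_EFinP; exact: measurable_normal_pdf.
  move=> x _; rewrite -!EFinM lee_fin !normal_pdfE// normal_peak2 /normal_fun !subr0.
  have := @cube_gauss_le (`|x| / s).
  rewrite divr_ge0 ?(ltW s0)// => /(_ isT).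
  have -> : (`|x| / s) ^+ 2 / 2 = x ^+ 2 / (s ^+ 2 *+ 2).
    by rewrite expr_div_n real_normK ?num_real//; field.
  have -> : (`|x| / s) ^+ 2 / 8 = x ^+ 2 / ((2 * s) ^+ 2 *+ 2).
    by rewrite expr_div_n real_normK ?num_real//; field.
  rewrite expr_div_n => h.
  rewrite !mulNr.
  have s30 : 0 < s ^+ 3 by rewrite exprn_gt0.
  rewrite mulrAC ler_pdivrMr// in h.
  rewrite mulrCA (_ : 30 * s ^+ 3 * _ = normal_peak s *
    (15 * expR (- (x ^+ 2 / ((2 * s) ^+ 2 *+ 2))) * s ^+ 3)); last by field.
  by rewrite ler_wpM2l// normal_peak_ge0.
rewrite ge0_integralZl//; last 3 first.
  - by apply/measurable_EFinP; exact: measurable_normal_pdf.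
  - by move=> x _; rewrite lee_fin normal_pdf_ge0.
  - by rewrite lee_fin mulr_ge0// exprn_ge0// ltW.
by rewrite integral_normal_pdf mule1.
Qed.

Lemma normal_small_ball s : 0 < s -> (N s `[(- 1)%R, 1%R] <= (2 / s)%:E)%E.
Proof.
move=> s0; have s_neq0 : s != 0 by rewrite gt_eqF.
rewrite /normal_prob.
apply: (@le_trans _ _ (\int[lebesgue_measure]_(x in `[(- 1)%R, 1%R]) (s^-1)%:E)%E).
  apply: ge0_le_integral => //=.
  - by move=> x _; rewrite lee_fin normal_pdf_ge0.
  - by apply/measurable_EFinP; apply: measurable_funTS; exact: measurable_normal_pdf.
  move=> x _; rewrite lee_fin (le_trans (normal_pdf_ub _ _ s_neq0))// /normal_peak.
  have s2 : s ^+ 2 <= s ^+ 2 * pi *+ 2.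
    rewrite -mulrnAr ler_peMr ?sqr_ge0//.
    by have := pi_ge2 R; rewrite mulr2n; lra.
  rewrite lef_pV2 ?posrE//.
    by rewrite -{1}(ger0_norm (ltW s0)) -sqrtr_sqr ler_wsqrtr.
  rewrite sqrtr_gt0 (lt_le_trans _ s2)// exprn_gt0//.
have h11 : - 1 < 1 :> R by lra.
rewrite integral_cst//= lebesgue_measure_itv/= lte_fin h11.
by rewrite -EFinB -EFinM lee_fin mulrC ler_wpM2r ?invr_ge0 ?(ltW s0)//; lra.
Qed.

End gauss.

(** * Independence *)

Section independence.
Context (R : realType) (d : measure_display) (Omega : measurableType d)
  (P : probability Omega R).

Lemma bounded_integrable (f : Omega -> R) (M : R) :
  measurable_fun setT f -> (forall w, `|f w| <= M) ->
  P.-integrable setT (EFin \o f).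
Proof.
move=> mf fM; apply: (@bounded_integrable_on _ _ _ _ _ measurableT _ _ M) => //.
by rewrite /= probability_setT ltry.
Qed.

Definition independent_sets (E F : set Omega) := P (E `&` F) = (P E * P F)%E.

(** Both $E \mapsto P(E \cap F)$ and $E \mapsto P(E)P(F)$ are finite measures, and they agree on the
    pi-system [G]. *)
Lemma independent_sets_sigma (G : set (set Omega)) (F : set Omega) :
  G `<=` measurable -> setI_closed G -> G setT -> measurable F ->
  (forall E, G E -> independent_sets E F) ->
  forall E, <<s G >> E -> independent_sets E F.
Proof.
move=> Gm GI GT mF GF E sGE.
have r0 : 0 <= fine (P F) by rewrite fine_ge0.
have PFE : (fine (P F))%:E = P F.
  by rewrite fineK// fin_num_measure.
rewrite /independent_sets muleC -PFE.
apply: (@g_sigma_algebra_measure_unique _ _ _ G Gm (fun _ => setT) _ _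
  (mrestr P mF) (mscale (NngNum r0) P)) => //.
- by rewrite bigcup_const.
- move=> A GA; rewrite /= /mrestr /mscale/= PFE muleC; exact: GF.
- by move=> _; rewrite /= /mrestr setTI (le_lt_trans (probability_le1 P mF))// ltry.
Qed.

Variable X : nat -> Omega -> R * R.
Hypothesis mX : forall i, measurable_fun setT (X i).
Hypothesis indX : forall n, independent_variables P (fun i : 'I_n => X i).

(** The sets are indexed by all of [nat], so a family can be prolonged from n to n + 1 variables
    without casts between ordinals. *)
Definition cylinders (n : nat) : set (set Omega) :=
  [set E | exists2 A : nat -> set (R * R), (forall i, measurable (A i)) &
     E = \bigcap_(i in [set i : 'I_n | True]) X i @^-1` A i].

Lemma measurable_cylinders n : cylinders n `<=` measurable.
Proof.
move=> _ [A mA ->]; apply: fin_bigcap_measurable; first exact: finite_finset.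
by move=> i _; rewrite -[_ @^-1` _]setTI; exact: mX.
Qed.

Lemma cylinders_setI n : setI_closed (cylinders n).
Proof.
move=> _ _ [A mA ->] [B mB ->]; exists (fun i => A i `&` B i).
  by move=> i; exact: measurableI.
apply/seteqP; split => w /= => [[wA wB] i _|wAB].
  by split; [exact: wA|exact: wB].
by split => i _; have [] := wAB i I.
Qed.

Lemma cylinders_independent n E B : measurable B -> cylinders n E ->
  independent_sets E (X n @^-1` B).
Proof.
move=> mB [A mA ->].
pose A1 C := fun i => if (i < n)%N then A i else C : set (R * R).
have mA1 C : measurable C -> forall i, measurable (A1 C i).
  by move=> mC i; rewrite /A1; case: ifP.
have E1 C : \bigcap_(i in [set: 'I_n.+1]) X i @^-1` A1 C i =
    \bigcap_(i in [set i : 'I_n | True]) X i @^-1` A i `&` X n @^-1` C.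
  apply/seteqP; split => w /= => [wA|[wA wC] i _].
    split=> [i _|]; last by have := wA ord_max I; rewrite /A1/= ltnn.
    by have := wA (widen_ord (leqnSn n) i) I; rewrite /A1/= ltn_ord.
  rewrite /A1; case: ifPn => [ilt|]; first exact: (wA (Ordinal ilt)).
  rewrite -leqNgt => ni; have -> : i = n :> nat; last exact: wC.
  by apply/eqP; rewrite eqn_leq ni andbT -ltnS.
have prodE C : measurable C ->
    P (\bigcap_(i in [set i : 'I_n | True]) X i @^-1` A i `&` X n @^-1` C) =
    ((\prod_(i < n) P (X i @^-1` A i)) * P (X n @^-1` C))%E.
  move=> mC; rewrite -E1 (@indX n.+1 (fun i => A1 C i)); last first.
    by move=> i; exact: mA1.
  rewrite big_ord_recr/= {2}/A1 ltnn; congr (_ * _)%E.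
  by apply: eq_bigr => i _; rewrite /A1/= ltn_ord.
(* Taking the whole plane as last set identifies the product of the first n factors with the
   probability of the cylinder. *)
have := prodE _ (@measurableT _ _); rewrite preimage_setT setIT => PE.
by rewrite /independent_sets prodE// PE probability_setT mule1.
Qed.

Lemma cylindersT n : cylinders n setT.
Proof. by exists (fun=> setT) => //; apply/seteqP; split. Qed.

Lemma measurable_cylinder_fun n i : (i < n)%N ->
  measurable_fun (setT : set (g_sigma_algebraType (cylinders n))) (X i).
Proof.
move=> ilt _ B mB; rewrite setTI; apply: sub_sigma_algebra.
exists (fun j => if j == i then B else setT).
  by move=> j; case: ifP.
apply/seteqP; split => w /= => [wB j _|/(_ (Ordinal ilt) I)/=]; last by rewrite eqxx.
by case: ifPn => // /eqP ->.
Qed.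

Lemma sigma_cylinders_independent n E B : measurable B ->
  <<s cylinders n >> E -> independent_sets E (X n @^-1` B).
Proof.
move=> mB; apply: independent_sets_sigma.
- exact: measurable_cylinders.
- exact: cylinders_setI.
- exact: cylindersT.
- by rewrite -[_ @^-1` _]setTI; exact: mX.
- by move=> E'; exact: cylinders_independent.
Qed.

End independence.

Lemma measure_eq_rectangles (d1 d2 : measure_display) (T1 : measurableType d1)
    (T2 : measurableType d2) (R : realType)
    (m1 m2 : {measure set (T1 * T2) -> \bar R}) :
  (m1 setT < +oo)%E ->
  (forall A B, measurable A -> measurable B -> m1 (A `*` B) = m2 (A `*` B)) ->
  forall C, measurable C -> m1 C = m2 C.
Proof.
move=> m1T m12 C mC.
apply: (@measure_unique _ _ _ [set A `*` B | A in measurable & B in measurable]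
  (fun _ => setT)) => //.
- exact: measurable_prod_measurableType.
- move=> _ _ [A1 mA1 [B1 mB1 <-]] [A2 mA2 [B2 mB2 <-]].
  by rewrite -setXI; exists (A1 `&` A2); [exact: measurableI|
    exists (B1 `&` B2) => //; exact: measurableI].
- by move=> _; exists setT => //; exists setT => //; rewrite setXTT.
- by rewrite bigcup_const.
- by move=> _ [A mA [B mB <-]]; exact: m12.
Qed.

Section rotate.
Context (R : realType) (d : measure_display) (Omega : measurableType d)
  (P : probability Omega R) (d' : measure_display) (E : measurableType d').
Variables (Y : Omega -> E) (X : Omega -> R * R) (F : E * (R * R) -> R) (M : R).
Hypotheses (mY : measurable_fun setT Y) (mX : measurable_fun setT X).
Hypothesis indXY : forall A B, measurable A -> measurable B ->
  P (Y @^-1` A `&` X @^-1` B) = (P (Y @^-1` A) * P (X @^-1` B))%E.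
Hypothesis rotX : forall B, measurable B ->
  P (X @^-1` (@rot90 R @^-1` B)) = P (X @^-1` B).
Hypotheses (mF : measurable_fun setT F) (FM : forall a, `|F a| <= M).

(** By independence the law of [(Y, X)] is a product on rectangles, and there rotating [X] changes
    nothing; so [(Y, X)] and [(Y, rot90 X)] have the same joint law. *)
Lemma integral_rot :
  \int[P]_w F (Y w, rot90 (X w)) = \int[P]_w F (Y w, X w).
Proof.
have mYX : measurable_fun setT (fun w => (Y w, X w)) by exact: measurable_fun_pair.
have mYrX : measurable_fun setT (fun w => (Y w, rot90 (X w))).
  apply: measurable_fun_pair => //; apply: measurableT_comp => //.
  exact: measurable_rot.
rewrite /Rintegral.
have push (h : Omega -> E * (R * R)) (mh : measurable_fun setT h) :
    (\int[P]_w (F (h w))%:E = \int[pushforward P h]_y (F y)%:E)%E.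
  rewrite integral_pushforward//; first exact/measurable_EFinP.
  rewrite preimage_setT; apply: (@bounded_integrable _ _ _ P (F \o h) M).
    exact: measurableT_comp.
  by move=> w; exact: FM.
rewrite (push _ mYX) (push _ mYrX); congr fine.
apply: (eq_measure_integral (measure_pushforward P mYX)
   (m1 := measure_pushforward P mYrX)) => A mA _.
apply: measure_eq_rectangles mA => [|B C mB mC].
  by rewrite /= /pushforward preimage_setT probability_setT ltry.
rewrite /= /pushforward.
transitivity (P (Y @^-1` B `&` X @^-1` (@rot90 R @^-1` C))) => //.
rewrite indXY//; last by rewrite -[_ @^-1` _]setTI; exact: measurable_rot.
by rewrite rotX// -indXY.
Qed.

End rotate.

(** * Stopped random walk *)

Section walk.
Context (R : realType) (d : measure_display) (Omega : measurableType d)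
  (P : probability Omega R).
Variables (S : nat -> Omega -> R * R) (p : R * R) (K : R).
Let X i w := S i.+1 w - S i w.
Hypotheses (S0 : forall w, S 0 w = p)
  (mS : forall i, measurable_fun setT (S i))
  (indX : forall n, independent_variables P (fun i : 'I_n => X i))
  (rotX : forall i B, measurable B ->
    P (X i @^-1` (@rot90 R @^-1` B)) = P (X i @^-1` B))
  (momX : forall i,
    (\int[P]_w (`|(X i w).1| ^+ 3 + `|(X i w).2| ^+ 3)%:E <= K%:E)%E).
Variables (rho : R * R -> R) (eps : R) (D : set (R * R)).
Hypotheses (mrho : measurable_fun setT rho) (rhoD : forall a, eps <= rho a -> D a).
Variables (g : R * R -> R) (M C : R).
Hypotheses (mg : measurable_fun setT g) (gM : forall a, `|g a| <= M) (C0 : 0 <= C).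
Hypothesis gC : forall a h, D a ->
  `|g (a + h) + g (a + rot90 h) + g (a + rot90 (rot90 h)) + g (a + rot90 (rot90 (rot90 h)))
    - 4 * g a| <= C * (`|h.1| ^+ 3 + `|h.2| ^+ 3).

Fixpoint alive n w := (eps <= rho (S n w)) && (if n is m.+1 then alive m w else true).

(** The walk moves as long as it was alive one step earlier, so it freezes at the first position
    with [rho] below [eps], overshoot included. *)
Fixpoint stopped n w := if n is m.+1 then
  (if alive m w then S m.+1 w else stopped m w) else S 0 w.

Lemma stopped_alive n w : alive n w -> stopped n w = S n w.
Proof. by case: n => [//|n] /= /andP[_ ->]. Qed.

Lemma measurable_pairD d' (T : measurableType d') (f h : T -> R * R) :
  measurable_fun setT f -> measurable_fun setT h ->
  measurable_fun setT (fun w => f w + h w).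
Proof.
move=> /measurable_fun_pairP[f1 f2] /measurable_fun_pairP[h1 h2].
by apply: measurable_fun_pair; exact: measurable_funD.
Qed.

Lemma measurable_pairB d' (T : measurableType d') (f h : T -> R * R) :
  measurable_fun setT f -> measurable_fun setT h ->
  measurable_fun setT (fun w => f w - h w).
Proof.
move=> /measurable_fun_pairP[f1 f2] /measurable_fun_pairP[h1 h2].
by apply: measurable_fun_pair; exact: measurable_funB.
Qed.

(** The domain is left free because [Omega] is used with two sigma-algebras: its own, and the one
    generated by the first increments. *)
Lemma measurable_alive_gen d' (T : measurableType d') (r : T -> Omega) n :
  (forall i, (i <= n)%N -> measurable_fun setT (S i \o r)) ->
  measurable_fun setT (alive n \o r).
Proof.
elim: n => [|n IH] mSr /=.
  apply: measurable_and => //; apply: measurable_fun_ler => //.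
  exact: (measurableT_comp mrho (mSr 0%N _)).
apply: measurable_and; last by apply: IH => i /leqW; exact: mSr.
by apply: measurable_fun_ler => //; exact: (measurableT_comp mrho (mSr n.+1 _)).
Qed.

Lemma measurable_alive n : measurable_fun setT (alive n).
Proof. by apply: (@measurable_alive_gen _ _ id) => i _; exact: mS. Qed.

Lemma measurable_stopped n : measurable_fun setT (stopped n).
Proof.
elim: n => [|n IH] /=; first exact: mS.
by apply: measurable_fun_ifT => //; exact: measurable_alive.
Qed.

Let mX i : measurable_fun setT (X i).
Proof. by apply: measurable_pairB; exact: mS. Qed.

Let Y n w := (alive n w, S n w).

Let mY n : measurable_fun setT (Y n).
Proof. by apply: measurable_fun_pair; [exact: measurable_alive|exact: mS]. Qed.

(** As [S 0] is constant, both components of [Y n] are functions of the first n increments, hence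
    independent of increment number n. *)
Let indXY n A B : measurable A -> measurable B ->
  P (Y n @^-1` A `&` X n @^-1` B) = (P (Y n @^-1` A) * P (X n @^-1` B))%E.
Proof.
move=> mA mB; apply: (sigma_cylinders_independent mX indX mB).
have mSn i : (i <= n)%N ->
    measurable_fun (setT : set (g_sigma_algebraType (cylinders X n))) (S i).
  elim: i => [_|i IH ilt].
    by rewrite (_ : S 0 = cst p)//; apply/funext => w; rewrite S0.
  rewrite (_ : S i.+1 = (fun w => S i w + X i w)); last first.
    by apply/funext => w; rewrite /X addrC subrK.
  apply: measurable_pairD; first exact: (IH (ltnW ilt)).
  exact: (@measurable_cylinder_fun _ _ _ X n i ilt).
have : measurable_fun (setT : set (g_sigma_algebraType (cylinders X n))) (Y n).
  apply: measurable_fun_pair; last exact: mSn.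
  exact: (@measurable_alive_gen _ (g_sigma_algebraType (cylinders X n)) id).
by move=> /(_ measurableT A mA); rewrite setTI.
Qed.

(** One step of [g] along the stopped walk, as a function of the past and of the fresh increment:
    the shape required by [integral_rot]. *)
Let F (y : (bool * (R * R)) * (R * R)) :=
  if y.1.1 then g (y.1.2 + y.2) - g y.1.2 else 0.

Let mF : measurable_fun setT F.
Proof.
have m12 : measurable_fun setT
    (fun y : (bool * (R * R)) * (R * R) => y.1.2).
  exact: (measurableT_comp measurable_snd measurable_fst).
apply: measurable_fun_ifT => //.
  exact: (measurableT_comp measurable_fst measurable_fst).
apply: measurable_funB; last exact: measurableT_comp.
apply: measurableT_comp => //; apply: measurable_pairD => //.
Qed.

Let FM y : `|F y| <= M + M.
Proof.
rewrite /F; case: ifP => _; first by rewrite (le_trans (ler_normB _ _))// lerD.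
by rewrite normr0 -mulr2n mulrn_wge0// (le_trans (normr_ge0 _) (gM 0)).
Qed.

Lemma walk_step n : `|\int[P]_w F (Y n w, X n w)| <= C * K.
Proof.
have mrot d' (T : measurableType d') (f : T -> R * R) : measurable_fun setT f ->
    measurable_fun setT (fun w => rot90 (f w)).
  by move=> mf; apply: measurableT_comp => //; exact: measurable_rot.
have mFr (r : R * R -> R * R) : measurable_fun setT r ->
    measurable_fun setT (fun y : (bool * (R * R)) * (R * R) => F (y.1, r y.2)).
  move=> mr; apply: measurableT_comp => //; apply: measurable_fun_pair => //.
  exact: measurableT_comp.
have m1 : measurable_fun setT (fun a : R * R => rot90 a) by exact: measurable_rot.
have e1 := integral_rot (mY n) (@mX n) (@indXY n) (@rotX n) mF FM.
(* Applying the invariance to [F] precomposed with one and then two quarter turns makes all four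
   rotated expectations equal, so their sum, the four-point defect, is four times the expected
   step. *)
have e2 := integral_rot (mY n) (@mX n) (@indXY n) (@rotX n) (mFr _ m1) (fun y => FM _).
have m2 := mrot _ _ _ m1.
have e3 := integral_rot (mY n) (@mX n) (@indXY n) (@rotX n) (mFr _ m2) (fun y => FM _).
have iF (r : R * R -> R * R) : measurable_fun setT r ->
    P.-integrable setT (EFin \o (fun w => F (Y n w, r (X n w)))).
  move=> mr; apply: (@bounded_integrable _ _ _ _ _ (M + M)) => //.
  apply: measurableT_comp => //; apply: measurable_fun_pair => //.
  exact: measurableT_comp.
rewrite /= in e2 e3.
pose f w := F (Y n w, X n w) + F (Y n w, rot90 (X n w)) +
  F (Y n w, rot90 (rot90 (X n w))) + F (Y n w, rot90 (rot90 (rot90 (X n w)))).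
have i0 := iF _ (@measurable_id _ _ setT).
have i1 := iF _ m1.
have i2 := iF _ m2.
have i3 := iF _ (mrot _ _ _ m2).
have iD (h1 h2 : Omega -> R) : P.-integrable setT (EFin \o h1) ->
    P.-integrable setT (EFin \o h2) ->
    P.-integrable setT (EFin \o (fun w => h1 w + h2 w)).
  by move=> i1' i2'; exact: (integrableD measurableT i1' i2').
have i01 := iD _ _ i0 i1.
have i012 := iD _ _ i01 i2.
have if_ : P.-integrable setT (EFin \o f) := iD _ _ i012 i3.
have fE : \int[P]_w f w = 4 * \int[P]_w F (Y n w, X n w).
  by rewrite /f (RintegralD _ i012 i3)// (RintegralD _ i01 i2)//
    (RintegralD _ i0 i1)// e3 e2 e1; ring.
suff : `|\int[P]_w f w| <= C * K.
  rewrite fE normrM ger0_norm//; have := normr_ge0 (\int[P]_w F (Y n w, X n w)).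
  lra.
rewrite -lee_fin EFin_normr_Rintegral//.
have mf' := measurable_int _ if_.
apply: (le_trans (le_abse_integral P measurableT mf')).
have mX3 : measurable_fun setT
    (fun w => (`|(X n w).1| ^+ 3 + `|(X n w).2| ^+ 3)%:E).
  have /measurable_fun_pairP[x1 x2] := @mX n.
  apply/measurable_EFinP; apply: measurable_funD; apply: measurable_funX;
    exact: (measurableT_comp (@normr_measurable _ setT)).
have X30 w : 0 <= `|(X n w).1| ^+ 3 + `|(X n w).2| ^+ 3.
  by rewrite addr_ge0// exprn_ge0.
rewrite EFinM; apply: (@le_trans _ _
   (\int[P]_w (C%:E * (`|(X n w).1| ^+ 3 + `|(X n w).2| ^+ 3)%:E))%E); last first.
  rewrite ge0_integralZl//; first by rewrite lee_wpmul2l// lee_fin.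
apply: ge0_le_integral => //.
- exact: (measurableT_comp (@abse_measurable _ setT) mf').
- exact: emeasurable_funM.
move=> w _; rewrite -EFinM lee_fin /f /F /Y/=.
case: ifPn => [aw|_]; last by rewrite !addr0 normr0 mulr_ge0.
have Dw : D (S n w) by apply: rhoD; case: (n) aw => /= [|m] /andP[].
apply: le_trans (gC (X n w) Dw).
rewrite (_ : _ + _ + _ + _ = g (S n w + X n w) + g (S n w + rot90 (X n w)) +
  g (S n w + rot90 (rot90 (X n w))) + g (S n w + rot90 (rot90 (rot90 (X n w))))
    - 4 * g (S n w))//.
by ring.
Qed.

Lemma stopped_walk_bound n :
  `|\int[P]_w g (stopped n w) - g p| <= n%:R * (C * K).
Proof.
have ig i : P.-integrable setT (EFin \o (fun w => g (stopped i w))).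
  apply: (@bounded_integrable _ _ _ _ _ M) => //.
  by apply: measurableT_comp => //; exact: measurable_stopped.
elim: n => [|n IH].
  rewrite mul0r /= (_ : (fun w => g (S 0 w)) = cst (g p)); last first.
    by apply/funext => w; rewrite S0.
  by rewrite Rintegral_cst//= probability_setT/= mulr1 subrr normr0.
have -> : \int[P]_w g (stopped n.+1 w) =
    \int[P]_w g (stopped n w) + \int[P]_w F (Y n w, X n w).
  rewrite -RintegralD//; last first.
    apply: (@bounded_integrable _ _ _ _ _ (M + M)) => //.
    by apply: measurableT_comp => //; exact: measurable_fun_pair.
  apply: eq_Rintegral => w _; rewrite /F /Y /=.
  case: ifPn => [aw|_]; last by rewrite addr0.
  by rewrite stopped_alive// /X [S n w + _]addrC subrK addrC subrK.
rewrite addrAC -natr1 mulrDl mul1r (le_trans (ler_normD _ _))// lerD//.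
exact: walk_step.
Qed.

End walk.

(** * Hitting times of a continuous path *)

Section path.
Variable R : realType.
Implicit Types (r f : R -> R) (t s e eps : R).
Local Notation halfline := `[0, +oo[%classic.

Lemma near_invS_lt (c : R) : 0 < c -> \forall k \near \oo, k.+1%:R^-1 < c.
Proof. by move=> c0; exact: (near_infty_natSinv_lt (PosNum c0)). Qed.

Lemma near_natr_ge (c : R) : \forall k \near \oo, c <= k%:R.
Proof.
exists (Num.truncn c).+1 => // k /= ck.
by rewrite (le_trans (ltW (truncnS_gt c)))// ler_nat.
Qed.

Lemma within_halfline_near f t e : {within halfline, continuous f} -> 0 <= t ->
  0 < e -> exists2 c, 0 < c & forall s, 0 <= s -> `|s - t| < c -> `|f s - f t| < e.
Proof.
move=> /subspace_continuousP cf t0 e0.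
have /cf : halfline t by rewrite /= in_itv/= t0.
move=> /cvgrPdist_lt/(_ e e0); rewrite near_withinE => -[c /= c0 H].
exists c => // s s0 st; rewrite distrC; apply: H; first by rewrite /= distrC.
by rewrite in_itv/= s0.
Qed.

Lemma within_halfline_cvg f t (s : nat -> R) : {within halfline, continuous f} ->
  0 <= t -> (forall n, 0 <= s n) -> s @ \oo --> t -> f (s n) @[n --> \oo] --> f t.
Proof.
move=> cf t0 s0 st; apply/cvgrPdist_lt => e e0.
have [c c0 H] := within_halfline_near cf t0 e0.
move/cvgrPdist_lt : st => /(_ c c0); apply: filterS => n; rewrite distrC => /H.
by rewrite distrC; exact.
Qed.

Lemma first_hit r : {within halfline, continuous r} ->
  (exists2 t, 0 <= t & r t <= 0) ->
  exists tau, [/\ 0 <= tau, r tau <= 0 & forall t, 0 <= t < tau -> 0 < r t].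
Proof.
move=> cr [t0 t00 rt0].
pose A := [set t | 0 <= t /\ r t <= 0].
have A0 : has_inf A by split; [exists t0|exists 0 => t []].
have infge0 : 0 <= inf A by apply: lb_le_inf; [exact: A0.1|move=> t []].
exists (inf A); split => //.
  rewrite leNgt; apply/negP => r0.
  have [c c0 H] := within_halfline_near cr infge0 r0.
  have [t [t1 rt] tlt] := inf_adherent c0 A0.
  have tge : inf A <= t by apply: ge_inf; [exact: A0.2|].
  have := H t t1; rewrite ger0_norm ?subr_ge0// ltrBlDl => /(_ tlt).
  by rewrite ltr_norml => /andP[+ _]; rewrite ltrBrDl subrr ltNge rt.
move=> t /andP[t1 tlt]; rewrite ltNge; apply/negP => rt.
by move: tlt; rewrite ltNge => /negP; apply; apply: ge_inf; [exact: A0.2|].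
Qed.

(* The horizon N is always a member, so the infimum is that of a nonempty set. *)
Definition hits r eps (N : R) : set R :=
  [set t | 0 <= t <= N /\ (r t < eps \/ t = N)].

Definition hit_inf r eps N := inf (hits r eps N).

Lemma has_inf_hits r eps N : 0 <= N -> has_inf (hits r eps N).
Proof.
move=> N0; split; last by exists 0 => t [/andP[]].
by exists N; split; [rewrite N0 lexx|right].
Qed.

Lemma hit_inf_ge0 r eps N : 0 <= N -> 0 <= hit_inf r eps N.
Proof.
move=> N0; apply: lb_le_inf; first exact: (has_inf_hits _ _ N0).1.
by move=> t [/andP[]].
Qed.

Lemma hit_inf_le r eps N t : 0 <= N -> hits r eps N t -> hit_inf r eps N <= t.
Proof. by move=> N0 ht; apply: ge_inf => //; exact: (has_inf_hits _ _ N0).2. Qed.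

Lemma hit_inf_leN r eps N : 0 <= N -> hit_inf r eps N <= N.
Proof. by move=> N0; apply: hit_inf_le => //; split; [rewrite N0 lexx|right]. Qed.

(** If [r] exceeded [eps] at the infimum it would do so nearby, so members close to the infimum
    could only be the horizon [N]; the point [t] excludes that. *)
Lemma hit_inf_rle r eps N t : {within halfline, continuous r} ->
  0 <= t <= N -> r t < eps -> r (hit_inf r eps N) <= eps.
Proof.
move=> cr /andP[t0 tN] rt.
have N0 : 0 <= N by exact: le_trans tN.
have tt : hit_inf r eps N <= t by apply: hit_inf_le => //; split; [rewrite t0|left].
rewrite leNgt; apply/negP => rgt.
have h0 := hit_inf_ge0 r eps N0.
have e0 : 0 < r (hit_inf r eps N) - eps by rewrite subr_gt0.
have [c c0 H] := within_halfline_near cr h0 e0.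
have above s : 0 <= s -> `|s - hit_inf r eps N| < c -> eps < r s.
  move=> s0 /(H _ s0); rewrite ltr_norml => /andP[+ _]; lra.
have tN' : hit_inf r eps N < N.
  rewrite lt_neqAle hit_inf_leN// andbT; apply/eqP => hN.
  have tE : t = N by apply/eqP; rewrite eq_le tN -hN.
  by move: rgt; rewrite hN -tE ltNge ltW.
have m0 : 0 < Num.min c (N - hit_inf r eps N) by rewrite lt_min c0 subr_gt0.
have [s [/andP[s0 sN] hs] slt] := inf_adherent m0 (has_inf_hits r eps N0).
rewrite -/(hit_inf r eps N) in slt.
have sge : hit_inf r eps N <= s by apply: hit_inf_le => //; split => //; rewrite s0.
have slt' : s - hit_inf r eps N < Num.min c (N - hit_inf r eps N) by rewrite ltrBlDl.
move: slt'; rewrite lt_min => /andP[s1 s2].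
have := above s s0; rewrite ger0_norm ?subr_ge0// => /(_ s1).
case: hs => [|sE]; first by move=> /ltW; rewrite leNgt => /negP.
by move: s2; rewrite sE ltxx.
Qed.

(** The grid time is a member of [hits], so it never precedes the infimum. Conversely a [t] with
    [r t < eps] has such points just to its left or at [t] itself, and a fine grid contains one of
    them. *)
Lemma grid_hit_cvg r eps (N : nat) (J : nat -> nat) :
  {within halfline, continuous r} ->
  (forall k, [/\ (J k <= N * k.+1 ^ 2)%N,
     forall i, (i < J k)%N -> eps <= r (i%:R / k.+1%:R ^+ 2) &
     J k = (N * k.+1 ^ 2)%N \/ r ((J k)%:R / k.+1%:R ^+ 2) < eps]) ->
  ((J k)%:R / k.+1%:R ^+ 2 : R) @[k --> \oo] --> hit_inf r eps N%:R.
Proof.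
move=> cr HJ; have N0 : 0 <= N%:R :> R by [].
have d0 k : 0 < k.+1%:R ^+ 2 :> R by rewrite exprn_gt0.
have grid_leN k i : (i <= N * k.+1 ^ 2)%N -> (i%:R / k.+1%:R ^+ 2 : R) <= N%:R.
  by move=> iN; rewrite ler_pdivrMr// -natrX -natrM ler_nat.
have lower k : hit_inf r eps N%:R <= (J k)%:R / k.+1%:R ^+ 2.
  have [JN _ JE] := HJ k.
  apply: hit_inf_le => //; split; first by rewrite divr_ge0//= grid_leN.
  case: JE => [->|]; [right|by left].
  by rewrite natrM natrX mulfK// gt_eqF.
apply/cvgrPdist_le => e e0.
have [t [/andP[t0 tN] ht] tlt] := inf_adherent e0 (has_inf_hits r eps N0).
rewrite -/(hit_inf r eps N%:R) in tlt.
suff : \forall k \near \oo, (J k)%:R / k.+1%:R ^+ 2 <= t.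
  apply: filterS => k kt; rewrite distrC ger0_norm ?subr_ge0//.
  by rewrite lerBlDl (le_trans kt)// ltW.
case: ht => [rt|->]; last first.
  by near=> k; have [JN _ _] := HJ k; exact: grid_leN.
have rt0 : 0 < eps - r t by rewrite subr_gt0.
have [c c0 H] := within_halfline_near cr t0 rt0.
near=> k.
have [JN Jlt _] := HJ k.
(* The last grid point not after [t]; it lies within [c] of [t] once the mesh is below [c]. *)
pose i := Num.truncn (t * k.+1%:R ^+ 2).
have ti0 : 0 <= t * k.+1%:R ^+ 2 by rewrite mulr_ge0// ltW.
have /andP[i1 i2] := truncn_itv ti0; rewrite -/i in i1 i2.
have it : (i%:R / k.+1%:R ^+ 2) <= t by rewrite ler_pdivrMr.
have ti : t - c < (i%:R / k.+1%:R ^+ 2).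
  rewrite ltr_pdivlMr//.
  have kc : 1 < c * k.+1%:R ^+ 2.
    have h1 : c^-1 < k.+1%:R.
      by rewrite invf_plt ?posrE//; near: k; exact: near_invS_lt.
    rewrite -ltr_pdivrMl// mulr1 (lt_le_trans h1)//.
    by rewrite expr2 ler_peMr// ler1n.
  by rewrite mulrBl; rewrite -natr1 in i2; lra.
have iN : (i <= N * k.+1 ^ 2)%N.
  rewrite -(ler_nat R) natrM natrX -ler_pdivrMr//; exact: le_trans tN.
rewrite (le_trans _ it)// ler_pM2r ?invr_gt0// ler_nat leqNgt; apply/negP => /Jlt.
have i0 : 0 <= i%:R / k.+1%:R ^+ 2 :> R by rewrite divr_ge0// ltW.
have := H _ i0; rewrite ler0_norm; last by rewrite subr_le0.
rewrite opprB ltrBlDr addrC -ltrBlDr => /(_ ti).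
by rewrite ltr_norml => /andP[_ ?] ?; lra.
Unshelve. all: by end_near. Qed.

(** On $[0, \tau - e]$ the function [r] has a positive minimum; once $1/(m+1)$ is below it and the
    horizon m is past $\tau$, the infimum lies in $[\tau - e, \tau]$. For $\tau \le e$ the lower
    bound is just nonnegativity. *)
Lemma hit_inf_cvg r tau : {within halfline, continuous r} -> 0 <= tau ->
  r tau <= 0 -> (forall t, 0 <= t < tau -> 0 < r t) ->
  hit_inf r m.+1%:R^-1 m%:R @[m --> \oo] --> tau.
Proof.
move=> cr tau0 rtau rpos.
have mtau := near_natr_ge tau.
apply/cvgrPdist_le => e e0.
have [te|te] := leP tau e.
  near=> m.
  have tm : tau <= m%:R by near: m.
  have hm : hit_inf r m.+1%:R^-1 m%:R <= tau.
    by apply: hit_inf_le => //; split; [rewrite tau0|left; rewrite (le_lt_trans rtau)].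
  rewrite ger0_norm ?subr_ge0// (le_trans _ te)// gerBl.
  exact: hit_inf_ge0.
have te0 : 0 <= tau - e by rewrite subr_ge0 ltW.
have cr' : {within `[0, tau - e], continuous r}.
  by apply: continuous_subspaceW cr => s /=; rewrite !in_itv/= => /andP[->].
have [c + cmin] := EVT_min te0 cr'; rewrite in_itv/= => /andP[c0 ce].
have rc0 : 0 < r c by apply: rpos; rewrite c0/=; lra.
near=> m.
have tm : tau <= m%:R by near: m.
have hm : hit_inf r m.+1%:R^-1 m%:R <= tau.
  by apply: hit_inf_le => //; split; [rewrite tau0|left; rewrite (le_lt_trans rtau)].
rewrite ger0_norm ?subr_ge0// lerBlDl -lerBlDr.
have rm : m.+1%:R^-1 < r c by near: m; exact: near_invS_lt.
apply: lb_le_inf; first exact: (has_inf_hits _ _ _).1.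
move=> t [/andP[t0 tm'] [rt|->]]; last by rewrite (le_trans _ tm)// gerBl ltW.
rewrite leNgt; apply/negP => tt.
have : r c <= r t by apply: cmin; rewrite in_itv/= t0 ltW.
by rewrite leNgt => /negP; apply; exact: lt_trans rm.
Unshelve. all: by end_near. Qed.

(** Turns a quantifier over uncountably many times into countably many conditions on stopped
    positions, which makes the exit event measurable. The converse is compactness: a path positive
    on $[0,N]$ is bounded away from 0 there. *)
Lemma hit_before_iff r (N : nat) : {within halfline, continuous r} ->
  (exists2 t, 0 <= t <= N%:R & r t <= 0) <->
  (forall m, r (hit_inf r m.+1%:R^-1 N%:R) <= m.+1%:R^-1).
Proof.
move=> cr; split=> [[t tN rt] m|H].
  by apply: (hit_inf_rle cr tN); rewrite (le_lt_trans rt).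
have cr' : {within `[0, N%:R], continuous r}.
  by apply: continuous_subspaceW cr => s /=; rewrite !in_itv/= => /andP[->].
have [c + cmin] := EVT_min (ler0n _ N) cr'; rewrite in_itv/= => cN.
exists c => //; rewrite leNgt; apply/negP => rc0.
have [m _ /(_ m (leqnn m))/= rm] := near_invS_lt rc0.
have := H m; rewrite leNgt => /negP; apply; apply: (lt_le_trans rm); apply: cmin.
by rewrite in_itv/= hit_inf_ge0//= hit_inf_leN.
Qed.

End path.

(** * Brownian motion sampled on a grid *)

Section stopped_index.
Context (R : realType) (d : measure_display) (Omega : measurableType d).
Variables (S : nat -> Omega -> R * R) (rho : R * R -> R) (eps : R).

Lemma aliveP n w :
  reflect (forall i, (i <= n)%N -> eps <= rho (S i w)) (alive S rho eps n w).
Proof.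
apply: (iffP idP); elim: n => [|n IH] /=.
- by rewrite andbT => h i; rewrite leqn0 => /eqP ->.
- by move=> /andP[h /IH H] i; rewrite leq_eqVlt => /predU1P[->//|]; exact: H.
- by move=> h; rewrite andbT h.
- by move=> h; rewrite h//= IH// => i /leqW /h.
Qed.

Lemma stopped_index n w : exists J, [/\ (J <= n)%N,
  stopped S rho eps n w = S J w,
  forall i, (i < J)%N -> eps <= rho (S i w) &
  J = n \/ rho (S J w) < eps].
Proof.
elim: n => [|n [J [Jn SJ HJ JE]]] /=; first by exists 0%N; split => //; left.
case: ifPn => [/aliveP a|/aliveP na].
  by exists n.+1; split => //; left.
exists J; split => //; first exact: leqW.
case: JE => [E|]; [right|by right].
rewrite ltNge; apply/negP => h; apply: na => i.
rewrite leq_eqVlt => /predU1P[->|]; first by rewrite -E.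
by rewrite -E; exact: HJ.
Qed.

End stopped_index.

Section brownian.
Context (R : realType) (d : measure_display) (Omega : measurableType d)
  (P : probability Omega R).
Variables (p : R * R) (W : R -> Omega -> R * R).
Hypotheses (bm : brownian_motion P p W).
Local Notation N s := (normal_prob (0 : R) s).
Local Notation TR := (measurableTypeR R).
Local Notation halfline := `[0, +oo[%classic.

Lemma bm_law1 s t (A : set R) : 0 <= s -> s < t -> measurable A ->
  P [set w | A (W t w - W s w).1] = N (Num.sqrt (t - s)) A.
Proof.
move=> s0 st mA.
have mAT : measurable (A `*` setT : set (R * R)) by exact: measurableX.
have h := bm_gaussian bm s0 st mAT; rewrite product_measure1E// in h.
have NT : N (Num.sqrt (t - s)) setT = 1%E by exact: probability_setT.
transitivity (P [set w | (A `*` setT) (W t w - W s w)]).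
  by congr (P _); apply/seteqP; split => w /= => [?|[]].
by rewrite h -[RHS]mule1 -NT.
Qed.

Lemma bm_law2 s t (A : set R) : 0 <= s -> s < t -> measurable A ->
  P [set w | A (W t w - W s w).2] = N (Num.sqrt (t - s)) A.
Proof.
move=> s0 st mA.
have mAT : measurable (setT `*` A : set (R * R)) by exact: measurableX.
have h := bm_gaussian bm s0 st mAT; rewrite product_measure1E// in h.
have NT : N (Num.sqrt (t - s)) setT = 1%E by exact: probability_setT.
transitivity (P [set w | (setT `*` A) (W t w - W s w)]).
  by congr (P _); apply/seteqP; split => w /= => [?|[]].
by rewrite h -[RHS]mul1e -NT.
Qed.

Lemma bm_increment s t : 0 <= s -> 0 <= t ->
  measurable_fun setT (fun w => W t w - W s w).
Proof. by move=> s0 t0; apply: measurable_pairB; exact: (bm_measurable bm). Qed.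

Lemma normal_law_third_moment (X : Omega -> R) s : 0 < s ->
  measurable_fun setT X ->
  (forall A : set R, measurable A -> P (X @^-1` A) = N s A) ->
  (\int[P]_w (`|X w| ^+ 3)%:E <= (30 * s ^+ 3)%:E)%E.
Proof.
move=> s0 mX XE.
have mX' : measurable_fun setT (X : Omega -> TR) by exact: mX.
have m3 : measurable_fun setT (fun x : TR => (`|x| ^+ 3)%:E).
  by apply/measurable_EFinP; apply: measurable_funX; exact: normr_measurable.
apply: le_trans (normal_third_moment s0).
rewrite (eq_measure_integral (measure_pushforward P mX')); last first.
  by move=> A mA _; rewrite /= /pushforward XE.
by rewrite /= ge0_integral_pushforward.
Qed.

Lemma bm_third_moment s t : 0 <= s -> s < t ->
  (\int[P]_w (`|(W t w - W s w).1| ^+ 3 + `|(W t w - W s w).2| ^+ 3)%:E <=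
   (60 * Num.sqrt (t - s) ^+ 3)%:E)%E.
Proof.
move=> s0 st; have st0 : 0 < Num.sqrt (t - s) by rewrite sqrtr_gt0 subr_gt0.
have t0 : 0 <= t by rewrite (le_trans s0)// ltW.
have /measurable_fun_pairP[m1 m2] := bm_increment s0 t0.
have M1 := normal_law_third_moment st0 m1 (fun A => @bm_law1 s t A s0 st).
have M2 := normal_law_third_moment st0 m2 (fun A => @bm_law2 s t A s0 st).
under eq_integral do rewrite EFinD.
have m3 (f : Omega -> R) : measurable_fun setT f ->
    measurable_fun setT (fun w => (`|f w| ^+ 3)%:E).
  move=> mf; apply/measurable_EFinP; apply: measurable_funX.
  exact: (measurableT_comp (@normr_measurable _ setT)).
rewrite ge0_integralD//; [|exact: (m3 _ m1)|exact: (m3 _ m2)].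
have -> : 60 * Num.sqrt (t - s) ^+ 3 =
  30 * Num.sqrt (t - s) ^+ 3 + 30 * Num.sqrt (t - s) ^+ 3 by ring.
by rewrite EFinD; apply: leeD.
Qed.

Lemma bm_rot s t B : 0 <= s -> s < t -> measurable B ->
  P ((fun w => W t w - W s w) @^-1` (@rot90 R @^-1` B)) =
  P ((fun w => W t w - W s w) @^-1` B).
Proof.
move=> s0 st mB.
have mrB : measurable (@rot90 R @^-1` B).
  by rewrite -[_ @^-1` _]setTI; exact: measurable_rot.
have := bm_gaussian bm s0 st mrB; have := bm_gaussian bm s0 st mB.
rewrite -[X in _ = X -> _]normal2_rot//; last by rewrite gt_eqF// sqrtr_gt0 subr_gt0.
by move=> h1 h2; rewrite -[RHS]/(P [set w | B (W t w - W s w)]) h1 -h2.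
Qed.

Variables (rho : R * R -> R) (D : set (R * R)).
Hypotheses (mrho : measurable_fun setT rho)
  (crho : forall w, {within halfline, continuous (fun t => rho (W t w))})
  (rhoD : forall a, 0 < rho a -> D a).

(** With a square as denominator, each increment has standard deviation exactly $1/(k+1)$ in every
    coordinate. *)
Let gridS k i w := W (i%:R / k.+1%:R ^+ 2) w.
Let Z m n k := stopped (gridS k) rho m.+1%:R^-1 (n * k.+1 ^ 2).

Definition exit_pos m n w :=
  W (hit_inf (fun t => rho (W t w)) m.+1%:R^-1 n%:R) w.

Let tge0 k i : 0 <= i%:R / k.+1%:R ^+ 2 :> R.
Proof. by rewrite divr_ge0// exprn_ge0. Qed.

Let tlt k i : i%:R / k.+1%:R ^+ 2 < i.+1%:R / k.+1%:R ^+ 2 :> R.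
Proof. by rewrite ltr_pM2r ?ltr_nat// invr_gt0 exprn_gt0. Qed.

Let mZ m n k : measurable_fun setT (Z m n k).
Proof.
by apply: measurable_stopped => // i; apply: (bm_measurable bm); exact: tge0.
Qed.

Let Z_cvg m n (f : R * R -> R) w : {within halfline, continuous (fun t => f (W t w))} ->
  f (Z m n k w) @[k --> \oo] --> f (exit_pos m n w).
Proof.
move=> cf; pose J k := sval (cid (stopped_index (gridS k) rho m.+1%:R^-1 (n * k.+1 ^ 2) w)).
have HJ k := svalP (cid (stopped_index (gridS k) rho m.+1%:R^-1 (n * k.+1 ^ 2) w)).
rewrite (_ : (fun k => _) = fun k => f (W ((J k)%:R / k.+1%:R ^+ 2) w)); last first.
  by apply/funext => k; have [_ + _ _] := HJ k; rewrite /Z => ->.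
apply: (within_halfline_cvg cf).
- exact: hit_inf_ge0.
- by move=> k; exact: tge0.
- apply: grid_hit_cvg => // k; have [? _ ? ?] := HJ k; by split.
Qed.

Hypothesis cW1 : forall w, {within halfline, continuous (fun t => (W t w).1)}.
Hypothesis cW2 : forall w, {within halfline, continuous (fun t => (W t w).2)}.

(** Obtained as a pointwise limit of the stopped grid walks, without discussing measurability of the
    hitting time or joint measurability of [W]. *)
Lemma measurable_exit_pos m n : measurable_fun setT (exit_pos m n).
Proof.
apply/measurable_fun_pairP; split.
  apply: (measurable_fun_cvg (h := fun k w => (Z m n k w).1)).
    by move=> k; exact: (measurableT_comp measurable_fst (mZ m n k)).
  by move=> w _; exact: (Z_cvg (f := fst)).
apply: (measurable_fun_cvg (h := fun k w => (Z m n k w).2)).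
  by move=> k; exact: (measurableT_comp measurable_snd (mZ m n k)).
by move=> w _; exact: (Z_cvg (f := snd)).
Qed.

Variables (g : R * R -> R) (M C : R).
Hypotheses (mg : measurable_fun setT g) (gM : forall a, `|g a| <= M) (C0 : 0 <= C)
  (cg : forall w, {within halfline, continuous (fun t => g (W t w))}).
Hypothesis gC : forall a h, D a ->
  `|g (a + h) + g (a + rot90 h) + g (a + rot90 (rot90 h)) + g (a + rot90 (rot90 (rot90 h)))
    - 4 * g a| <= C * (`|h.1| ^+ 3 + `|h.2| ^+ 3).

Lemma exit_pos_mean m n : \int[P]_w g (exit_pos m n w) = g p.
Proof.
(* There are $n(k+1)^2$ steps, each costing at most $60\,C/(k+1)^3$. *)
have bound k : `|\int[P]_w g (Z m n k w) - g p| <= n%:R * C * 60 / k.+1%:R.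
  have e0 : 0 < m.+1%:R^-1 :> R by rewrite invr_gt0.
  have sqE i : Num.sqrt (i.+1%:R / k.+1%:R ^+ 2 - i%:R / k.+1%:R ^+ 2) = k.+1%:R^-1 :> R.
    rewrite -mulrBl -natr1 addrC addKr mul1r sqrtrV ?exprn_ge0// sqrtr_sqr.
    by rewrite ger0_norm.
  have := @stopped_walk_bound _ _ _ P (gridS k) p (60 * k.+1%:R^-1 ^+ 3)
    _ _ _ _ _ rho m.+1%:R^-1 D mrho (fun a h => rhoD (lt_le_trans e0 h)) g M C mg gM
    C0 gC (n * k.+1 ^ 2).
  rewrite -/(Z m n k).
  move=> /(_ _ _ _ _ _) H; apply: le_trans (H _ _ _ _ _) _.
  - by move=> w; rewrite /gridS mul0r (bm_start bm).
  - by move=> i; apply: (bm_measurable bm); exact: tge0.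
  - move=> j; apply: (@bm_independent _ _ _ _ _ _ bm j (fun i => i%:R / k.+1%:R ^+ 2)).
      exact: tge0.
    by move=> i; exact/ltW/tlt.
  - by move=> i B mB; apply: bm_rot.
  - by move=> i; have := bm_third_moment (tge0 k i) (tlt k i); rewrite sqE.
  rewrite natrM natrX le_eqVlt; apply/orP; left; apply/eqP.
  by field; rewrite addrC natr1 pnatr_eq0.
have c1 : \int[P]_w g (Z m n k w) @[k --> \oo] --> \int[P]_w g (exit_pos m n w).
  apply: (@bounded_cvg_Rintegral _ _ _ _ _ measurableT _ _ _ M).
  - by rewrite /= probability_setT ltry.
  - by move=> k; exact: (measurableT_comp mg (mZ m n k)).
  - by move=> k w _; exact: gM.
  - by move=> w _; exact: Z_cvg.
have c2 : \int[P]_w g (Z m n k w) @[k --> \oo] --> g p.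
  apply/cvgrPdist_le => e e0; near=> k.
  rewrite distrC (le_trans (bound k))//.
  have : k.+1%:R^-1 < e / (n%:R * C * 60 + 1).
    near: k; apply: near_invS_lt; rewrite divr_gt0// ltr_wpDl// !mulr_ge0//.
  have n0 : 0 <= n%:R * C * 60 by rewrite !mulr_ge0.
  rewrite ltr_pdivlMr ?ltr_wpDl// mulrDr mulr1 => /ltW; apply: le_trans.
  by rewrite mulrC lerDl invr_ge0.
exact: (cvg_unique _ c1 c2).
Unshelve. all: by end_near. Qed.

End brownian.

(** * Boundary values on the triangle *)

Section bracket_facts.
Variable R : realType.
Implicit Types (k x y : R) (a : R * R).

Lemma continuous_sinh : continuous (@sinh R).
Proof.
move=> x; apply: cvgM; last exact: cvg_cst.
apply: cvgB; first exact: continuous_expR.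
by apply: continuous_comp; [exact: oppr_continuous|exact: continuous_expR].
Qed.

Lemma continuous_clamp (M : R) : continuous (clamp M).
Proof.
move=> x; apply: (@continuous_max R R (fun=> - M) (fun x => Num.min M x)).
  exact: cvg_cst.
apply: (@continuous_min R R (fun=> M) id); first exact: cvg_cst.
exact: cvg_id.
Qed.

Section continuity.
Variables (T : topologicalType) (f h : T -> R).
Hypotheses (cf : continuous f) (ch : continuous h).

Lemma continuous_sin_clamp_sinh k : continuous (fun t => sin_clamp_sinh k (f t) (h t)).
Proof.
move=> t; apply: cvgM.
  apply: (continuous_comp (f := fun t => k * f t) (g := sin)); last exact: continuous_sin.
  by apply: cvgM; [exact: cvg_cst|exact: cf].
apply: (continuous_comp (f := fun t => sinh (k * h t))); last exact: continuous_clamp.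
apply: (continuous_comp (f := fun t => k * h t)); last exact: continuous_sinh.
by apply: cvgM; [exact: cvg_cst|exact: ch].
Qed.

End continuity.

(** The space [T] is arbitrary so that it can be a subspace of the time axis, where Brownian paths
    are continuous. *)
Lemma continuous_bracket (T : topologicalType) (w : T -> R * R) k :
  continuous (fun t => (w t).1) -> continuous (fun t => (w t).2) ->
  continuous (fun t => bracket k (w t)).
Proof.
move=> c1 c2.
have cx : continuous (fun t => ((w t).1 + (w t).2) / 2).
  by move=> t; apply: cvgM; [apply: cvgD; [exact: c1|exact: c2]|exact: cvg_cst].
have cy : continuous (fun t => ((w t).1 - (w t).2) / 2).
  by move=> t; apply: cvgM; [apply: cvgB; [exact: c1|exact: c2]|exact: cvg_cst].
have cx' : continuous (fun t => 1 - ((w t).1 + (w t).2) / 2).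
  by move=> t; apply: cvgB; [exact: cvg_cst|exact: cx].
have cy' : continuous (fun t => 1 - ((w t).1 - (w t).2) / 2).
  by move=> t; apply: cvgB; [exact: cvg_cst|exact: cy].
move=> t; apply: cvgB; last exact: (continuous_sin_clamp_sinh cy' cx').
apply: cvgB; last exact: (continuous_sin_clamp_sinh cy cx).
apply: cvgD; first exact: (continuous_sin_clamp_sinh cx cy).
exact: (continuous_sin_clamp_sinh cx' cy').
Qed.

Lemma measurable_sin_clamp_sinh d (T : measurableType d) (f h : T -> R) k :
  measurable_fun setT f -> measurable_fun setT h ->
  measurable_fun setT (fun t => sin_clamp_sinh k (f t) (h t)).
Proof.
move=> mf mh; apply: measurable_funM.
  apply: (measurableT_comp (f := sin)).
    exact: (continuous_measurable_fun (@continuous_sin R)).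
  by apply: measurable_funM.
apply: (measurableT_comp (f := clamp _)).
  exact: (continuous_measurable_fun (@continuous_clamp _)).
apply: (measurableT_comp (f := @sinh R)).
  exact: (continuous_measurable_fun continuous_sinh).
by apply: measurable_funM.
Qed.

Lemma measurable_bracket k : measurable_fun setT (bracket k).
Proof.
have m1 : measurable_fun setT (fun a : R * R => (a.1 + a.2) / 2).
  by apply: measurable_funM => //; apply: measurable_funD.
have m2 : measurable_fun setT (fun a : R * R => (a.1 - a.2) / 2).
  by apply: measurable_funM => //; apply: measurable_funB.
have m1' : measurable_fun setT (fun a : R * R => 1 - (a.1 + a.2) / 2).
  exact: measurable_funB.
have m2' : measurable_fun setT (fun a : R * R => 1 - (a.1 - a.2) / 2).
  exact: measurable_funB.
apply: measurable_funB; last exact: measurable_sin_clamp_sinh.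
apply: measurable_funB; last exact: measurable_sin_clamp_sinh.
by apply: measurable_funD; exact: measurable_sin_clamp_sinh.
Qed.

Lemma sinh0 : sinh 0 = 0 :> R.
Proof. by rewrite /sinh oppr0 subrr mul0r. Qed.

Lemma sin_natpi n : sin (n%:R * pi) = 0 :> R.
Proof.
elim: n => [|n IH]; first by rewrite mul0r sin0.
by rewrite -natr1 mulrDl mul1r sinDpi IH oppr0.
Qed.

(** The legs are $x = y$ and $x + y = 1$, where the four terms cancel in pairs, clamped or not. *)
Lemma bracket_legs k a : a.2 = 0 \/ a.1 = 1 -> bracket k a = 0.
Proof.
rewrite /bracket; case=> ->; first by rewrite subr0 addr0; ring.
have -> : (1 - a.2) / 2 = 1 - (1 + a.2) / 2 by field.
by rewrite subKr; ring.
Qed.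

Lemma bracket_diag n a : 0 <= a.1 <= 1 -> a.1 = a.2 ->
  bracket (n%:R * pi) a = sin (n%:R * pi * (1 - a.1)) * sinh (n%:R * pi).
Proof.
move=> /andP[a0 a1] a12; rewrite /bracket -a12 subrr mul0r subr0.
have -> : (a.1 + a.1) / 2 = a.1 by field.
have np0 : 0 <= n%:R * pi :> R by rewrite mulr_ge0 ?pi_ge0.
have i0 : 0 <= (0 : R) <= 1 by apply/andP; split; lra.
have i1 : 0 <= (1 : R) <= 1 by apply/andP; split; lra.
have i2 : 0 <= a.1 <= 1 by rewrite a0.
have i3 : 0 <= 1 - a.1 <= 1 by apply/andP; split; lra.
rewrite !sin_clamp_sinhE//.
by rewrite !mulr0 !mulr1 sinh0 sin0 sin_natpi; ring.
Qed.

(** A stand-in for the signed Euclidean distance: positive inside the triangle, zero on its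
    boundary, negative outside. *)
Definition tri_dist a : R := Num.min a.2 (Num.min (1 - a.1) (a.1 - a.2)).

Lemma tri_dist_gt0 a : 0 < tri_dist a -> [/\ 0 < a.2, a.1 < 1 & a.2 < a.1].
Proof. by rewrite /tri_dist !lt_min !subr_gt0 => /and3P[]. Qed.

Lemma tri_dist_ge0 a : (0 <= tri_dist a) <-> triangle a.
Proof.
rewrite /tri_dist !le_min !subr_ge0; split; first by move=> /and3P[? ? ?]; split.
by move=> [? ? ?]; apply/and3P.
Qed.

Lemma tri_dist_eq0 a : tri_dist a = 0 -> [\/ a.2 = 0, a.1 = 1 | a.1 = a.2].
Proof.
rewrite /tri_dist /Num.min; case: ifP => _; first by constructor 1.
by case: ifP => _ h; [constructor 2|constructor 3]; apply/eqP; rewrite -subr_eq0;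
  apply/eqP; lra.
Qed.

Lemma continuous_tri_dist (T : topologicalType) (w : T -> R * R) :
  continuous (fun t => (w t).1) -> continuous (fun t => (w t).2) ->
  continuous (fun t => tri_dist (w t)).
Proof.
move=> c1 c2 t.
apply: (@continuous_min R T (fun t => (w t).2)
  (fun t => Num.min (1 - (w t).1) ((w t).1 - (w t).2))); first exact: c2.
apply: (@continuous_min R T (fun t => 1 - (w t).1) (fun t => (w t).1 - (w t).2)).
  by apply: cvgB; [exact: cvg_cst|exact: c1].
by apply: cvgB; [exact: c1|exact: c2].
Qed.

Lemma measurable_tri_dist : measurable_fun setT tri_dist.
Proof.
apply: measurable_minr => //; apply: measurable_minr; exact: measurable_funB.
Qed.

End bracket_facts.

(** * Exit from the triangle *)

Section within_pair.
Variables (R : realType) (w : R -> R * R) (A : set R).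
Hypothesis cw : {within A, continuous w}.

Lemma continuous_within_fst : {within A, continuous (fun t => (w t).1)}.
Proof.
move=> t.
exact: (@continuous_comp (subspace A) (R * R)%type R w fst t (@cw t) cvg_fst).
Qed.

Lemma continuous_within_snd : {within A, continuous (fun t => (w t).2)}.
Proof.
move=> t.
exact: (@continuous_comp (subspace A) (R * R)%type R w snd t (@cw t) cvg_snd).
Qed.

Lemma continuous_within_tri_dist : {within A, continuous (fun t => tri_dist (w t))}.
Proof.
exact: (@continuous_tri_dist R (subspace A) w continuous_within_fst
  continuous_within_snd).
Qed.

Lemma continuous_within_bracket k : {within A, continuous (fun t => bracket k (w t))}.
Proof.
exact: (@continuous_bracket R (subspace A) w k continuous_within_fst
  continuous_within_snd).
Qed.

End within_pair.

Section exit.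
Context (R : realType) (d : measure_display) (Omega : measurableType d)
  (P : probability Omega R).
Variables (p : R * R) (W : R -> Omega -> R * R).
Hypotheses (bm : brownian_motion P p W) (tp : triangle p).
Local Notation halfline := `[0, +oo[%classic.

Let r w t := tri_dist (W t w).

Lemma bm_continuous1 w : {within halfline, continuous (fun t => (W t w).1)}.
Proof.
exact: (@continuous_within_fst R (W ^~ w) halfline (@bm_continuous _ _ _ _ _ _ bm w)).
Qed.

Lemma bm_continuous2 w : {within halfline, continuous (fun t => (W t w).2)}.
Proof.
exact: (@continuous_within_snd R (W ^~ w) halfline (@bm_continuous _ _ _ _ _ _ bm w)).
Qed.

Lemma bm_continuous_tri w : {within halfline, continuous (r w)}.
Proof.
exact: (@continuous_within_tri_dist R (W ^~ w) halfline
  (@bm_continuous _ _ _ _ _ _ bm w)).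
Qed.

Definition exits_before (n : nat) : set Omega :=
  [set w | exists2 t, 0 <= t <= n%:R & r w t <= 0].

Definition exits : set Omega := \bigcup_n exits_before n.

Lemma exitsP w : exits w <-> exists2 t, 0 <= t & r w t <= 0.
Proof.
split=> [[n _ [t /andP[t0 _] rt]]|[t t0 rt]]; first by exists t.
exists (Num.truncn t).+1 => //; exists t => //.
by rewrite t0 ltW// truncnS_gt.
Qed.

Lemma measurable_exits_before n : measurable (exits_before n).
Proof.
have -> : exits_before n =
    \bigcap_m [set w | tri_dist (exit_pos W (@tri_dist R) m n w) <= m.+1%:R^-1].
  apply/seteqP; split=> w /=; have := hit_before_iff n (@bm_continuous_tri w).
    by move=> [H _] /H h m _; exact: h.
  by move=> [_ H] h; apply: H => m; exact: h.
apply: bigcap_measurableType => m _.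
have mp : measurable_fun setT (exit_pos W (@tri_dist R) m n).
  apply: (measurable_exit_pos bm (@measurable_tri_dist R)) => w.
  - exact: bm_continuous_tri.
  - exact: bm_continuous1.
  - exact: bm_continuous2.
have := measurable_fun_ler (measurableT_comp (@measurable_tri_dist R) mp)
  (measurable_cst (m.+1%:R^-1 : R)).
by move=> /(_ measurableT [set true]); rewrite setTI; exact.
Qed.

Lemma measurable_exits : measurable exits.
Proof. by apply: bigcup_measurable => n _; exact: measurable_exits_before. Qed.

(** A path that never exits has its first coordinate within 1 of its start at every time; at time
    $(n+1)^2$ this has probability at most $2/(n+1)$. *)
Lemma exits_null : P (~` exits) = 0%E.
Proof.
have le n : (P (~` exits) <= (2 / n.+1%:R)%:E)%E.
  pose T : R := n.+1%:R ^+ 2.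
  have T0 : 0 < T by rewrite exprn_gt0.
  have sT : Num.sqrt (T - 0) = n.+1%:R by rewrite subr0 sqrtr_sqr ger0_norm.
  apply: le_trans (normal_small_ball (_ : 0 < n.+1%:R)) => //.
  rewrite -sT -(bm_law1 bm (lexx 0) T0)//.
  apply: le_measure; rewrite ?inE.
  - exact/measurableC/measurable_exits.
  - have /measurable_fun_pairP[+ _] := bm_increment bm (lexx 0) (ltW T0).
    move=> /(_ measurableT `[(- 1)%R, 1%R]%classic); rewrite setTI; apply.
    exact: measurable_itv.
  move=> w nw; have : 0 < r w T.
    rewrite ltNge; apply/negP => rT; apply: nw; apply/exitsP.
    by exists T => //; exact: ltW.
  move=> /tri_dist_gt0[h1 h2 h3]; case: tp => h4 h5 h6.
  by rewrite /= (bm_start bm) in_itv/=; apply/andP; split; lra.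
apply/eqP; rewrite eq_le measure_ge0 andbT.
apply/lee_addgt0Pr => e e0; rewrite add0e.
have e20 : 0 < e / 2 by rewrite divr_gt0.
have [m _ /(_ m (leqnn m))/= rm] := near_invS_lt e20.
by apply: (le_trans (le m)); rewrite lee_fin mulrC -ler_pdivlMr// ltW.
Qed.

(* Junk value 0 on the null set of paths that never leave the triangle. *)
Definition exit_time w : R := xget 0
  [set tau | [/\ 0 <= tau, r w tau <= 0 & forall t, 0 <= t < tau -> 0 < r w t]].

Definition exit_pt w := W (exit_time w) w.

(** The equality to 0 is what places the exit point on the boundary: a negative value would by
    continuity also occur slightly earlier, and at time 0 it is excluded by the start in the
    triangle. *)
Lemma exit_timeP w : exits w ->
  [/\ 0 <= exit_time w, r w (exit_time w) = 0 &
      forall t, 0 <= t < exit_time w -> 0 < r w t].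
Proof.
move=> /exitsP ew; have [tau Htau] := first_hit (@bm_continuous_tri w) ew.
have : [set tau | [/\ 0 <= tau, r w tau <= 0 & forall t, 0 <= t < tau -> 0 < r w t]]
    (exit_time w) by apply: xgetPex; exists tau.
move=> [t0 rt tlt]; split => //.
apply/eqP; rewrite eq_le rt/= leNgt; apply/negP => rneg.
have [t_eq0|t_gt0] := eqVneq (exit_time w) 0.
  by move: rneg; rewrite t_eq0 /r (bm_start bm) ltNge => /negP; apply; exact/tri_dist_ge0.
have tgt0 : 0 < exit_time w by rewrite lt_neqAle eq_sym t_gt0.
have e0 : 0 < - r w (exit_time w) by rewrite oppr_gt0.
have [c c0 H] := within_halfline_near (@bm_continuous_tri w) t0 e0.
pose s := Num.max 0 (exit_time w - c / 2).
have s0 : 0 <= s by rewrite /s le_max lexx.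
have slt : s < exit_time w by rewrite /s gt_max tgt0/=; lra.
have sgt : exit_time w - c / 2 <= s by rewrite /s le_max lexx orbT.
have := H s s0; rewrite ltr0_norm ?subr_lt0// opprB => /(_ _)/wrap[]; first by lra.
have := tlt s; rewrite s0 slt => /(_ isT) rs.
by rewrite ltr_norml => /andP[_]; lra.
Qed.

Lemma exit_pt_triangle w : exits w -> triangle (exit_pt w).
Proof. by move=> /exit_timeP[_ h _]; apply/tri_dist_ge0; rewrite -/(r w _) h. Qed.

Let exit_seq_cvg (f : R * R -> R) w :
  {within halfline, continuous (fun t => f (W t w))} -> exits w ->
  f (exit_pos W (@tri_dist R) m m w) @[m --> \oo] --> f (exit_pt w).
Proof.
move=> cf /exit_timeP[t0 rt tlt].
apply: (within_halfline_cvg cf t0) => [m|]; first exact: hit_inf_ge0.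
by apply: hit_inf_cvg => //; [exact: bm_continuous_tri|rewrite -/(r w _) rt].
Qed.

Let mpos m : measurable_fun setT (exit_pos W (@tri_dist R) m m).
Proof.
apply: (measurable_exit_pos bm (@measurable_tri_dist R)) => w.
- exact: bm_continuous_tri.
- exact: bm_continuous1.
- exact: bm_continuous2.
Qed.

Lemma measurable_exit_pt1 : measurable_fun exits (fun w => (exit_pt w).1).
Proof.
apply: (measurable_fun_cvg (h := fun m w => (exit_pos W (@tri_dist R) m m w).1)).
  by move=> m; apply: measurable_funTS; exact: (measurableT_comp measurable_fst (@mpos m)).
by move=> w ew; apply: (exit_seq_cvg (f := fst)) => //; exact: bm_continuous1.
Qed.

Lemma measurable_exit_pt2 : measurable_fun exits (fun w => (exit_pt w).2).
Proof.
apply: (measurable_fun_cvg (h := fun m w => (exit_pos W (@tri_dist R) m m w).2)).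
  by move=> m; apply: measurable_funTS; exact: (measurableT_comp measurable_snd (@mpos m)).
by move=> w ew; apply: (exit_seq_cvg (f := snd)) => //; exact: bm_continuous2.
Qed.

Lemma exit_mean k : 0 < k -> \int[P]_(w in exits) bracket k (exit_pt w) = bracket k p.
Proof.
move=> k0; have [C [C0 HC]] := bracket_four_point k0.
have cb w : {within halfline, continuous (fun t => bracket k (W t w))}.
  exact: (@continuous_within_bracket R (W ^~ w) halfline
    (@bm_continuous _ _ _ _ _ _ bm w)).
have mean m := exit_pos_mean bm (@measurable_tri_dist R) (fun w => @bm_continuous_tri w)
  (fun a h => (tri_dist_ge0 a).1 (ltW h)) (@measurable_bracket R k)
  (bracket_norm_le k) C0 cb HC m m.
have mbp m : measurable_fun setT (fun w => bracket k (exit_pos W (@tri_dist R) m m w)).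
  exact: (measurableT_comp (@measurable_bracket R k) (@mpos m)).
(* Pathwise convergence to the exit point is available only on [exits], so the null complement is
   dropped before the limit in m. *)
have {}mean m : \int[P]_(w in exits) bracket k (exit_pos W (@tri_dist R) m m w) = bracket k p.
  rewrite -(mean m) /Rintegral; congr fine.
  rewrite [RHS](@negligible_integral _ _ _ _ _ (~` exits))//.
  - by rewrite setDE setCK setTI.
  - exact/measurableC/measurable_exits.
  - apply: (@bounded_integrable _ _ _ _ _ (4 * expR (k + 1)) (mbp m)) => w.
    exact: bracket_norm_le.
  - exact: exits_null.
have h : \int[P]_(w in exits) bracket k (exit_pos W (@tri_dist R) m m w) @[m --> \oo]
    --> \int[P]_(w in exits) bracket k (exit_pt w).
  apply: (@bounded_cvg_Rintegral _ _ _ P _ measurable_exits _ _ _ (4 * expR (k + 1))).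
  - by rewrite (le_lt_trans (probability_le1 _ measurable_exits)) ?ltry.
  - by move=> m; exact: measurable_funTS.
  - by move=> m w _; exact: bracket_norm_le.
  - by move=> w; exact: exit_seq_cvg.
move: h; under eq_cvg do rewrite mean.
by move=> h; apply: (cvg_unique _ h (cvg_cst _)).
Qed.

(** The corners are left out because they belong to the boundary of the square, where the diagonal
    is not hit strictly first. *)
Definition exits_diag : set Omega :=
  exits `&` [set w | (exit_pt w).1 = (exit_pt w).2 /\ 0 < (exit_pt w).1 < 1].

Lemma measurable_exits_diag (B : set R) : measurable B ->
  measurable (exits_diag `&` [set w | B (exit_pt w).1]).
Proof.
move=> mB.
have -> : exits_diag `&` [set w | B (exit_pt w).1] =
    (exits `&` (fun w => (exit_pt w).1 == (exit_pt w).2) @^-1` [set true]) `&`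
    (exits `&` (fun w => (exit_pt w).1) @^-1` (B `&` `]0, 1[)).
  apply/seteqP; split => w /=; rewrite in_itv/=.
    by move=> [[ew [e ?]] ?]; split; [split => //; exact/eqP|].
  by move=> [[ew /eqP e] [_ []]].
apply: measurableI.
  exact: (measurable_fun_eqr measurable_exit_pt1 measurable_exit_pt2 measurable_exits).
apply: measurable_exit_pt1; first exact: measurable_exits.
by apply: measurableI => //; exact: measurable_itv.
Qed.

Lemma measurable_exits_diagT : measurable exits_diag.
Proof. by have := measurable_exits_diag measurableT; rewrite setIT. Qed.

Lemma measurable_exit_pt1_diag : measurable_fun exits_diag (fun w => (exit_pt w).1).
Proof.
apply: measurable_funS measurable_exit_pt1; first exact: measurable_exits.
exact: subIsetl.
Qed.

(** The difference to [exit_mean] consists of exits through the legs, where [bracket] is 0, and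
    through the corners, where the sine is 0. *)
Lemma exits_diag_mean n : (0 < n)%N ->
  (\int[P]_(w in exits_diag) sin (n%:R * pi * (1 - (exit_pt w).1))) * sinh (n%:R * pi) =
  bracket (n%:R * pi) p.
Proof.
move=> n0; have k0 : 0 < n%:R * pi :> R by rewrite mulr_gt0 ?ltr0n// pi_gt0.
rewrite -(exit_mean k0) -RintegralZr; last 2 first.
- exact: measurable_exits_diagT.
- apply: (@bounded_integrable_on _ _ _ _ _ measurable_exits_diagT _ _ 1).
  + by rewrite (le_lt_trans (probability_le1 _ measurable_exits_diagT)) ?ltry.
  + apply: (measurableT_comp (f := sin)).
      exact: (continuous_measurable_fun (@continuous_sin R)).
    apply: measurable_funM => //; apply: measurable_funB => //.
    exact: measurable_exit_pt1_diag.
  + by move=> w _; exact: sin_max.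
rewrite Rintegral_mkcond [RHS]Rintegral_mkcond; apply: eq_Rintegral => w _.
rewrite !patchE; case: ifPn => [|wd].
  rewrite inE => -[ew [d12 /andP[d0 d1]]]; rewrite mem_set//.
  by rewrite bracket_diag// (ltW d0) ltW.
case: ifPn => // /set_mem ew.
have [_ rt _] := exit_timeP ew; have [v0 u1 vu] := exit_pt_triangle ew.
case: (tri_dist_eq0 rt) => [h|h|h]; rewrite -/(exit_pt w) in h.
- by rewrite bracket_legs//; left.
- by rewrite bracket_legs//; right.
have x1 : 0 <= (exit_pt w).1 <= 1 by rewrite u1 h v0.
rewrite bracket_diag//.
have [x0|x0] := eqVneq (exit_pt w).1 0; first by rewrite x0 subr0 mulr1 sin_natpi mul0r.
have [x1'|x1'] := eqVneq (exit_pt w).1 1; first by rewrite x1' subrr mulr0 sin0 mul0r.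
exfalso; move/negP: wd; apply; rewrite inE; split => //; split => //.
by case/andP: x1 => ? ?; rewrite !lt_neqAle eq_sym x0 x1'; apply/andP.
Qed.

End exit.

(** * The event of hitting the diagonal first *)

Section square_boundary.
Variable R : realType.
Implicit Type a : R * R.

Lemma nbhs_segment01 (x : R) : nbhs x (`[0, 1]%classic : set R) <-> 0 < x < 1.
Proof.
split=> [|x01]; last first.
  apply: (@filterS _ _ _ `]0, 1[%classic); first exact: subset_itv_oo_cc.
  by apply: near_in_itvoo; rewrite in_itv.
move=> /nbhs_ballP[e /= e0 xe].
have in01 y : `|x - y| < e -> 0 <= y <= 1.
  by move=> xy; have := xe y xy; rewrite /= in_itv.
have /andP[h1 _] : 0 <= x - e / 2 <= 1.
  by apply: in01; rewrite opprB addrC subrK ger0_norm; lra.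
have /andP[_ h2] : 0 <= x + e / 2 <= 1.
  by apply: in01; rewrite opprD addrA subrr sub0r normrN ger0_norm; lra.
by apply/andP; split; lra.
Qed.

Lemma interior_unit_square a :
  (@unit_square R)^° a <-> (0 < a.1 < 1 /\ 0 < a.2 < 1).
Proof.
case: a => x y /=; split.
  move=> [[A B] /= [nA nB] AB].
  have Ax := nbhs_singleton nA; have By := nbhs_singleton nB.
  split; apply/nbhs_segment01.
    by apply: filterS nA => x' Ax'; have [] := AB (x', y) (conj Ax' By).
  by apply: filterS nB => y' By'; have [] := AB (x, y') (conj Ax By').
move=> [/nbhs_segment01 nx /nbhs_segment01 ny].
by exists (`[0, 1]%classic, `[0, 1]%classic) => //=.
Qed.

Lemma sq_boundary_inside a : @unit_square R a ->
  sq_boundary R a <-> ~ (0 < a.1 < 1 /\ 0 < a.2 < 1).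
Proof.
move=> sa; split=> [[_ ni] /interior_unit_square//|na].
by split; [exact: subset_closure|move=> /interior_unit_square].
Qed.

Lemma not_sq_boundary a : 0 < a.1 < 1 -> 0 < a.2 < 1 -> ~ sq_boundary R a.
Proof. by move=> a1 a2 [_]; apply; apply/interior_unit_square. Qed.

Lemma triangle_unit_square a : triangle a -> @unit_square R a.
Proof.
by move=> [? ? ?]; split; rewrite /= in_itv/=; apply/andP; split; lra.
Qed.

End square_boundary.

Section hitting.
Context (R : realType) (d : measure_display) (Omega : measurableType d)
  (P : probability Omega R).
Variables (p : R * R) (W : R -> Omega -> R * R).
Hypotheses (bm : brownian_motion P p W) (tp : triangle p).

Lemma hitting_time_le (A : set (R * R)) w t : 0 <= t -> A (W t w) ->
  (hitting_time W A w <= t%:E)%E.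
Proof. by move=> t0 At; apply: ereal_inf_lbound; exists t. Qed.

(** Before the exit the path is in the open triangle, off both sets. The exit point is interior to
    the square, so the path avoids the boundary for a further time [c]; this gap makes the
    inequality between infima strict. *)
Lemma exits_diag_hit w : exits_diag W w ->
  hitting_time W (sq_diag R) w = (exit_time W w)%:E /\
  ((exit_time W w)%:E < hitting_time W (sq_boundary R) w)%E.
Proof.
move=> [ew [d12 d01]]; have [t0 rt tlt] := exit_timeP bm tp ew.
rewrite -/(exit_pt W w) in rt.
split.
  apply/eqP; rewrite eq_le hitting_time_le//=; last first.
    split; last exact: d12.
    by apply: triangle_unit_square; exact: (exit_pt_triangle bm tp ew).
  apply: le_ereal_inf_tmp => _ [t [t1 [_ /= Dt]] <-]; rewrite lee_fin leNgt.
  apply/negP => tl; have := tlt t; rewrite t1 tl => /(_ isT) /tri_dist_gt0[_ _].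
  by rewrite Dt ltxx.
case/andP: (d01) => d0 d1.
have m0 : 0 < Num.min (exit_pt W w).1 (1 - (exit_pt W w).1).
  by rewrite lt_min d0 subr_gt0.
have [c1 c10 H1] := within_halfline_near (@bm_continuous1 _ _ _ _ _ _ bm w) t0 m0.
have [c2 c20 H2] := within_halfline_near (@bm_continuous2 _ _ _ _ _ _ bm w) t0 m0.
pose c := Num.min c1 c2.
have c0 : 0 < c by rewrite lt_min c10 c20.
apply: (@lt_le_trans _ _ (exit_time W w + c)%:E); first by rewrite lte_fin ltrDl.
apply: le_ereal_inf_tmp => _ [t [t1 /= St] <-]; rewrite lee_fin leNgt.
apply/negP => tl.
have [tt|tt] := ltP t (exit_time W w).
  have := tlt t; rewrite t1 tt => /(_ isT) /tri_dist_gt0[h1 h2 h3].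
  by apply: not_sq_boundary St; apply/andP; split => //;
    [exact: lt_trans h3|exact: lt_trans h2].
have tc : `|t - exit_time W w| < c by rewrite ger0_norm ?subr_ge0// ltrBlDl.
move: tc; rewrite lt_min => /andP[tc1 tc2].
have := H1 t t1 tc1; have := H2 t t1 tc2; rewrite -!/(exit_pt W w) -d12.
rewrite !lt_min !ltr_norml => /andP[/andP[? ?] /andP[? ?]] /andP[/andP[? ?] /andP[? ?]].
by apply: not_sq_boundary St; apply/andP; split; lra.
Qed.

(** A visit to the diagonal forces an exit no later. The exit point cannot lie on the boundary of
    the square, which would then be hit too early, so the exit is through the open diagonal. *)
Lemma hit_exits_diag w :
  (hitting_time W (sq_diag R) w < hitting_time W (sq_boundary R) w)%E ->
  exits_diag W w.
Proof.
move=> /ereal_inf_lt[_ [t [t0 [sqt /= Dt]] <-] tS].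
have ew : exits W w.
  apply/exitsP; exists t => //; rewrite /tri_dist Dt subrr.
  by rewrite ge_min; apply/orP; right; rewrite ge_min lexx orbT.
have [T0 rt tlt] := exit_timeP bm tp ew.
have Tt : exit_time W w <= t.
  rewrite leNgt; apply/negP => tT; have := tlt t; rewrite t0 tT => /(_ isT).
  by move=> /tri_dist_gt0[_ _]; rewrite Dt ltxx.
have nS : ~ sq_boundary R (exit_pt W w).
  move=> S; have := le_lt_trans (_ : ((exit_time W w)%:E <= t%:E)%E) tS.
  rewrite lee_fin => /(_ Tt); rewrite ltNge => /negP; apply.
  exact: hitting_time_le.
have tri := exit_pt_triangle bm tp ew.
have sq := triangle_unit_square tri.
have : 0 < (exit_pt W w).1 < 1 /\ 0 < (exit_pt W w).2 < 1.
  by apply: contrapT => h; apply: nS; apply/sq_boundary_inside.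
move=> [d1 d2]; split=> //; split => //.
by case: (tri_dist_eq0 rt) => // h; [move: d2|move: d1];
  rewrite /exit_pt h ltxx ?andbF.
Qed.

Lemma diag_hit_probE (B : set R) :
  diag_hit_prob P W B = P (exits_diag W `&` [set w | B (exit_pt W w).1]).
Proof.
congr (P _); apply/seteqP; split => w /= [h Bw].
  have ed := hit_exits_diag h; have [e _] := exits_diag_hit ed.
  by split => //; rewrite e in Bw.
by have [-> ?] := exits_diag_hit h.
Qed.

End hitting.

(** * Sine sums approximating indicators *)

Section sign_iteration.
Variable R : realType.
Implicit Types x c z : R.

Definition sign_step x : R := x * (3 - x ^+ 2) / 2.

Lemma sign_stepN x : sign_step (- x) = - sign_step x.
Proof. by rewrite /sign_step sqrrN; ring. Qed.

(** One step multiplies the distance to 1 by $1 - (y+y^2)/2$, at most $1 - x/2$ because the iterates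
    never fall below [x]. *)
Lemma sign_step_iter_pos x n : 0 < x <= 1 ->
  x <= iter n sign_step x <= 1 /\ 1 - iter n sign_step x <= (1 - x / 2) ^+ n.
Proof.
move=> /andP[x0 x1]; elim: n => [|n [/andP[h1 h2] h3]] /=.
  by rewrite lexx x1 expr0 gerBl ltW.
set y := iter n sign_step x in h1 h2 h3 *.
have yy : 1 - sign_step y = (1 - y) * (1 - (y + y ^+ 2) / 2).
  by rewrite /sign_step; field.
have y2 : y ^+ 2 <= y by rewrite expr2 ler_piMr// (le_trans (ltW x0)).
have y20 := sqr_ge0 y.
have q0 : 0 <= 1 - (y + y ^+ 2) / 2 by lra.
have qx : 1 - (y + y ^+ 2) / 2 <= 1 - x / 2 by lra.
have y10 : 0 <= 1 - y by rewrite subr_ge0.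
have ge : y <= sign_step y.
  rewrite -subr_ge0 (_ : _ - _ = y * (1 - y ^+ 2) / 2); last first.
    by rewrite /sign_step; field.
  by rewrite divr_ge0// mulr_ge0//; lra.
split; first by rewrite (le_trans h1 ge)/= -subr_ge0 yy mulr_ge0.
by rewrite yy [leRHS]exprSr; apply: ler_pM.
Qed.

Lemma sign_step_iterN x n : iter n sign_step (- x) = - iter n sign_step x.
Proof. by elim: n => [//|n IH]; rewrite !iterS IH sign_stepN. Qed.

Lemma sign_step_iter0 n : iter n sign_step 0 = 0.
Proof. by elim: n => [//|n IH]; rewrite iterS IH /sign_step !mul0r. Qed.

Lemma sign_step_iter_le1 x n : `|x| <= 1 -> `|iter n sign_step x| <= 1.
Proof.
have pos y : 0 < y <= 1 -> `|iter n sign_step y| <= 1.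
  move=> y01; have [/andP[h1 h2] _] := sign_step_iter_pos n y01.
  by case/andP: y01 => y0 _; rewrite ger0_norm// (le_trans (ltW y0)).
have [x0 x1|x0 x1|->] := ltrgt0P x; last by rewrite sign_step_iter0 normr0.
  by apply: pos; rewrite x0.
rewrite -(opprK x) sign_step_iterN normrN; apply: pos.
by rewrite oppr_gt0 x0.
Qed.

Lemma sign_step_cvg x : `|x| <= 1 ->
  iter n sign_step x @[n --> \oo] --> Num.sg x.
Proof.
have pos y : 0 < y <= 1 -> iter n sign_step y @[n --> \oo] --> (1 : R).
  move=> y01; case/andP: (y01) => y0 y1.
  have q : `|1 - y / 2| < 1 by rewrite ger0_norm; lra.
  apply: (@squeeze_cvgr _ _ _ _ (fun n => 1 - (1 - y / 2) ^+ n) (fun _ => 1)).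
  - apply: nearW => n; have [/andP[h1 h2] h3] := sign_step_iter_pos n y01.
    by rewrite h2 andbT; lra.
  - rewrite -[X in _ --> X]subr0; apply: cvgB; first exact: cvg_cst.
    have := cvg_geometric 1 q; rewrite /geometric/=.
    by under eq_cvg do rewrite mul1r.
  - exact: cvg_cst.
have [x0 x1|x0 x1|-> _] := ltrgt0P x.
- by rewrite gtr0_sg//; apply: pos; rewrite x0.
- have e n : iter n sign_step x = - iter n sign_step (- x).
    by rewrite -sign_step_iterN opprK.
  rewrite ltr0_sg//; under eq_cvg do rewrite e.
  by apply: cvgN; apply: pos; rewrite oppr_gt0 x0.
- by rewrite sgr0; under eq_cvg do rewrite sign_step_iter0; exact: cvg_cst.
Qed.

(** The index n = 0 is allowed and gives the zero function, which occurs when the first sine is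
    multiplied by the cosine. *)
Inductive sine_sum : (R -> R) -> Prop :=
| sine_sum_sin n : sine_sum (fun z => sin (n%:R * pi * (1 - z)))
| sine_sumD f g : sine_sum f -> sine_sum g -> sine_sum (fun z => f z + g z)
| sine_sumZ c f : sine_sum f -> sine_sum (fun z => c * f z).

(** Encodes parity: a product of two sines leaves the span, but polynomials in the cosine, and so
    squares of sine polynomials, preserve it. *)
Definition sine_multiplier (a : R -> R) :=
  forall f, sine_sum f -> sine_sum (fun z => a z * f z).

Lemma sine_sum_ext f g : f =1 g -> sine_sum f -> sine_sum g.
Proof. by move=> /funext ->. Qed.

Lemma sine_multiplier_ext f g : f =1 g -> sine_multiplier f -> sine_multiplier g.
Proof. by move=> /funext ->. Qed.

Lemma sine_multiplier_cst c : sine_multiplier (fun _ => c).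
Proof. by move=> f; exact: sine_sumZ. Qed.

Lemma sine_multiplierD a b : sine_multiplier a -> sine_multiplier b ->
  sine_multiplier (fun z => a z + b z).
Proof.
move=> ha hb f hf.
apply: (@sine_sum_ext (fun z => a z * f z + b z * f z)).
  by move=> z; rewrite mulrDl.
by apply: sine_sumD; [exact: ha|exact: hb].
Qed.

Lemma sine_multiplierM a b : sine_multiplier a -> sine_multiplier b ->
  sine_multiplier (fun z => a z * b z).
Proof.
move=> ha hb f hf; apply: (@sine_sum_ext (fun z => a z * (b z * f z))).
  by move=> z; rewrite mulrA.
by apply: ha; exact: hb.
Qed.

Lemma sine_multiplier_cos : sine_multiplier (fun z => cos (pi * (1 - z))).
Proof.
move=> f; elim => [n|g h _ hg _ hh|c g _ hg].
- case: n => [|n].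
    apply: sine_sum_ext (sine_sum_sin 0) => z.
    by rewrite mul0r mul0r sin0 mulr0.
  apply: sine_sum_ext (sine_sumZ 2^-1 (sine_sumD (sine_sum_sin n.+2) (sine_sum_sin n))).
  move=> z; set t := pi * (1 - z).
  have -> : n.+2%:R * pi * (1 - z) = n.+1%:R * pi * (1 - z) + t.
    by rewrite -[n.+2%:R]natr1 /t; ring.
  have -> : n%:R * pi * (1 - z) = n.+1%:R * pi * (1 - z) - t.
    by rewrite -[n.+1%:R]natr1 /t; ring.
  by rewrite sinD sinB; field.
- by apply: sine_sum_ext (sine_sumD hg hh) => z; rewrite [RHS]mulrDr.
- by apply: sine_sum_ext (sine_sumZ c hg) => z; rewrite [LHS]mulrCA.
Qed.

Lemma sine_multiplier_step a : sine_multiplier a ->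
  sine_multiplier (fun z => sign_step (a z)).
Proof.
move=> ha; apply: (@sine_multiplier_ext
   (fun z => a z * (3 / 2 + (- 2^-1) * (a z * a z)))).
  by move=> z; rewrite /sign_step; field.
apply: sine_multiplierM => //; apply: sine_multiplierD; first exact: sine_multiplier_cst.
apply: sine_multiplierM; first exact: sine_multiplier_cst.
exact: sine_multiplierM.
Qed.

Definition sine_flat n z := iter n sign_step (sin (pi * (1 - z))).

(** Since $\cos(\pi(1-z))$ increases on $[0,1]$, the iterates tend to the sign of $c - z$. *)
Definition cos_sign c n z :=
  iter n sign_step ((cos (pi * (1 - c)) - cos (pi * (1 - z))) / 2).

(** The two claims need a joint induction: a [sign_step] multiplies by a function of the square, and
    only the square is a multiplier. *)
Lemma sine_sum_flat n : sine_sum (sine_flat n) /\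
  sine_multiplier (fun z => sine_flat n z * sine_flat n z).
Proof.
elim: n => [|n [IH1 IH2]].
  split.
    apply: sine_sum_ext (sine_sum_sin 1) => z.
    by rewrite /sine_flat/= mul1r.
  apply: (@sine_multiplier_ext
    (fun z => 1 + (-1) * (cos (pi * (1 - z)) * cos (pi * (1 - z))))).
    by move=> z; rewrite /sine_flat/= -!expr2 sin2cos2 mulN1r.
  apply: sine_multiplierD; first exact: sine_multiplier_cst.
  apply: sine_multiplierM; first exact: sine_multiplier_cst.
  by apply: sine_multiplierM; exact: sine_multiplier_cos.
have m3 : sine_multiplier (fun z => 3 / 2 + (- 2^-1) * (sine_flat n z * sine_flat n z)).
  apply: sine_multiplierD; first exact: sine_multiplier_cst.
  by apply: sine_multiplierM => //; exact: sine_multiplier_cst.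
have E z : sine_flat n.+1 z =
    (3 / 2 + (- 2^-1) * (sine_flat n z * sine_flat n z)) * sine_flat n z.
  by rewrite /sine_flat/= /sign_step; field.
split; first by apply: sine_sum_ext (m3 _ IH1) => z; rewrite E.
apply: (@sine_multiplier_ext (fun z =>
  (3 / 2 + - 2^-1 * (sine_flat n z * sine_flat n z)) *
  ((3 / 2 + - 2^-1 * (sine_flat n z * sine_flat n z)) *
   (sine_flat n z * sine_flat n z)))).
  by move=> z; rewrite !E; ring.
by apply: sine_multiplierM => //; exact: sine_multiplierM.
Qed.

Lemma sine_multiplier_cos_sign c n : sine_multiplier (cos_sign c n).
Proof.
elim: n => [|n IH]; last exact: sine_multiplier_step IH.
apply: (@sine_multiplier_ext (fun z =>
  cos (pi * (1 - c)) / 2 + (- 2^-1) * cos (pi * (1 - z)))).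
  by move=> z; rewrite /cos_sign/=; field.
apply: sine_multiplierD; first exact: sine_multiplier_cst.
by apply: sine_multiplierM; [exact: sine_multiplier_cst|exact: sine_multiplier_cos].
Qed.

(** The polynomial $t(t+1)/2$ sends $-1, 0, 1$ to $0, 0, 1$, giving the strict indicator of $z < c$
    even at $z = c$. The factor [sine_flat], tending to 1 on $(0,1)$, turns a multiplier into a sine
    sum. *)
Definition sine_step_approx c n z :=
  sine_flat n z * (cos_sign c n z * (cos_sign c n z + 1) / 2).

Lemma sine_sum_step_approx c n : sine_sum (sine_step_approx c n).
Proof.
have [h _] := sine_sum_flat n.
have m : sine_multiplier (fun z => cos_sign c n z * ((cos_sign c n z + 1) * 2^-1)).
  have mc := @sine_multiplier_cos_sign c n.
  apply: sine_multiplierM => //; apply: sine_multiplierM; last exact: sine_multiplier_cst.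
  by apply: sine_multiplierD => //; exact: sine_multiplier_cst.
by apply: sine_sum_ext (m _ h) => z; rewrite /sine_step_approx; ring.
Qed.

Lemma cos_sign_arg_le1 c z :
  `|(cos (pi * (1 - c)) - cos (pi * (1 - z))) / 2| <= 1.
Proof.
have := cos_max (pi * (1 - c)); have := cos_max (pi * (1 - z)).
rewrite !ler_norml => /andP[? ?] /andP[? ?]; apply/andP; split; lra.
Qed.

Lemma sine_step_approx_le1 c n z : `|sine_step_approx c n z| <= 1.
Proof.
rewrite /sine_step_approx normrM -[leRHS]mul1r ler_pM//.
  by apply: sign_step_iter_le1; exact: sin_max.
have : `|cos_sign c n z| <= 1.
  by apply: sign_step_iter_le1; exact: cos_sign_arg_le1.
rewrite !ler_norml => /andP[? ?]; apply/andP; split; nra.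
Qed.

Lemma sine_step_approx_cvg c z : 0 <= c <= 1 -> 0 < z < 1 ->
  sine_step_approx c n z @[n --> \oo] --> ((z < c)%R%:R : R).
Proof.
move=> /andP[c0 c1] /andP[z0 z1].
have pi0 := pi_gt0 R.
have s0 : 0 < sin (pi * (1 - z)).
  apply: sin_gt0_pi; rewrite mulr_gt0 ?subr_gt0//=.
  by rewrite gtr_pMr// gtrBl.
have cs := sign_step_cvg (cos_sign_arg_le1 c z).
have fl : sine_flat n z @[n --> \oo] --> (1 : R).
  by have := sign_step_cvg (sin_max (pi * (1 - z))); rewrite gtr0_sg.
have -> : (z < c)%R%:R = 1 * (Num.sg ((cos (pi * (1 - c)) - cos (pi * (1 - z))) / 2) *
    (Num.sg ((cos (pi * (1 - c)) - cos (pi * (1 - z))) / 2) + 1) / 2) :> R.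
  have cosE : (cos (pi * (1 - z)) < cos (pi * (1 - c))) = (z < c).
    have in0pi t : 0 <= t <= 1 -> pi * (1 - t) \in `[0 : R, pi].
      move=> /andP[t0 t1]; rewrite in_itv/= mulr_ge0 ?(ltW pi0) ?subr_ge0//=.
      by rewrite ler_piMr ?(ltW pi0)// gerBl.
    rewrite ltr_cos ?in0pi ?c0 ?c1 ?(ltW z0) ?(ltW z1)//.
    by rewrite ltr_pM2l// ltrD2l ltrN2.
  rewrite -cosE; case: (ltrgtP (cos (pi * (1 - z)))) => [lt|gt|->].
  - by rewrite gtr0_sg /=; [field|rewrite divr_gt0 ?subr_gt0].
  - by rewrite ltr0_sg /=; [field|rewrite pmulr_llt0 ?invr_gt0// subr_lt0].
  - by rewrite subrr mul0r sgr0 /=; field.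
apply: cvgM => //; apply: cvgM; last exact: cvg_cst.
by apply: cvgM => //; apply: cvgD => //; exact: cvg_cst.
Qed.

Lemma measurable_sine_sum f : sine_sum f -> measurable_fun setT f.
Proof.
elim => [n|g h _ mg _ mh|c g _ mg].
- apply: (measurableT_comp (f := sin)).
    exact: (continuous_measurable_fun (@continuous_sin R)).
  by apply: measurable_funM => //; apply: measurable_funB.
- exact: measurable_funD.
- exact: measurable_funM.
Qed.

Lemma sine_sum_bounded f : sine_sum f -> exists M, forall z, `|f z| <= M.
Proof.
elim => [n|g h _ [M1 H1] _ [M2 H2]|c g _ [M1 H1]].
- by exists 1 => z; exact: sin_max.
- by exists (M1 + M2) => z; rewrite (le_trans (ler_normD _ _))// lerD.
- by exists (`|c| * M1) => z; rewrite normrM ler_wpM2l.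
Qed.

End sign_iteration.

(** * Sine moments determine the law *)

Section moments.
Context (R : realType) (d : measure_display) (Omega : measurableType d)
  (P : probability Omega R).
Variables (E : set Omega) (Y : Omega -> R) (h : R -> R) (H : R).
Local Notation mu := (@lebesgue_measure R).
Local Notation D := (`]0, 1[%classic : set (measurableTypeR R)).
Hypotheses (mE : measurable E) (mY : measurable_fun E Y)
  (Y01 : forall w, E w -> 0 < Y w < 1)
  (mh : measurable_fun D h) (hH : forall z, D z -> `|h z| <= H).
Hypothesis moment : forall n, (0 < n)%N ->
  \int[P]_(w in E) sin (n%:R * pi * (1 - Y w)) =
  \int[mu]_(z in D) (sin (n%:R * pi * (1 - z)) * h z).

Let muD : (mu D < +oo)%E.
Proof. by rewrite /= lebesgue_measure_itv/= lte_fin ltr01 -EFinB ltry. Qed.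

Let mD : measurable D.
Proof. exact: measurable_itv. Qed.

Let PE : (P E < +oo)%E.
Proof. by rewrite (le_lt_trans (probability_le1 _ mE)) ?ltry. Qed.

Let mfY (f : R -> R) : measurable_fun setT f -> measurable_fun E (fun w => f (Y w)).
Proof. by move=> mf; exact: (measurableT_comp mf mY). Qed.

Let mfh (f : R -> R) : measurable_fun setT f -> measurable_fun D (fun z => f z * h z).
Proof. by move=> mf; apply: measurable_funM => //; exact: measurable_funTS. Qed.

Let fhM (f : R -> R) M : (forall z, `|f z| <= M) -> forall z, D z -> `|f z * h z| <= M * H.
Proof. by move=> fM z Dz; rewrite normrM ler_pM// hH. Qed.

Lemma sine_sum_moment f : sine_sum f ->
  \int[P]_(w in E) f (Y w) = \int[mu]_(z in D) (f z * h z).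
Proof.
have iE g : sine_sum g -> P.-integrable E (EFin \o (fun w => g (Y w))).
  move=> sg; have [M gM] := sine_sum_bounded sg.
  apply: (@bounded_integrable_on _ _ _ _ _ mE PE _ M) => //.
  exact: (mfY (measurable_sine_sum sg)).
have iD g : sine_sum g -> mu.-integrable D (EFin \o (fun z => g z * h z)).
  move=> sg; have [M gM] := sine_sum_bounded sg.
  apply: (@bounded_integrable_on _ _ _ mu _ mD muD _ (M * H)).
    exact: (mfh (measurable_sine_sum sg)).
  exact: fhM.
elim => [n|g1 g2 s1 IH1 s2 IH2|c g sg IH].
- have [->|n0] := posnP n; last exact: moment.
  under eq_Rintegral do rewrite mul0r mul0r sin0.
  under [RHS]eq_Rintegral do rewrite mul0r mul0r sin0 mul0r.
  by rewrite !Rintegral_cst//= !mul0r.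
- under [RHS]eq_Rintegral do rewrite mulrDl.
  by rewrite (RintegralD mE (iE _ s1) (iE _ s2)) (RintegralD mD (iD _ s1) (iD _ s2)) IH1 IH2.
- under [RHS]eq_Rintegral do rewrite -mulrA.
  by rewrite (RintegralZl _ mE (iE _ sg)) (RintegralZl _ mD (iD _ sg)) IH.
Qed.

Lemma initial_segment_moment c : 0 <= c <= 1 ->
  \int[P]_(w in E) (Y w < c)%R%:R = \int[mu]_(z in D) ((z < c)%R%:R * h z).
Proof.
move=> c01.
have s n := sine_sum_step_approx c n.
have c1 : \int[P]_(w in E) sine_step_approx c n (Y w) @[n --> \oo] -->
    \int[P]_(w in E) ((Y w < c)%R%:R : R).
  apply: (@bounded_cvg_Rintegral _ _ _ _ _ mE PE _ _ 1).
  - by move=> n; exact: (mfY (measurable_sine_sum (s n))).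
  - by move=> n w _; exact: sine_step_approx_le1.
  - by move=> w Ew; apply: sine_step_approx_cvg => //; exact: Y01.
have c2 : \int[mu]_(z in D) (sine_step_approx c n z * h z) @[n --> \oo] -->
    \int[mu]_(z in D) ((z < c)%R%:R * h z).
  apply: (@bounded_cvg_Rintegral _ _ _ mu _ mD muD _ _ (1 * H)).
  - by move=> n; exact: (mfh (measurable_sine_sum (s n))).
  - by move=> n; apply: fhM => z; exact: sine_step_approx_le1.
  - move=> z; rewrite /= in_itv/= => z01.
    by apply: cvgM; [exact: sine_step_approx_cvg|exact: cvg_cst].
move: c1; under eq_cvg do rewrite (sine_sum_moment (s _)).
by move=> c1; exact: (cvg_unique _ c1 c2).
Qed.

Let ih : mu.-integrable D (EFin \o h).
Proof. exact: (@bounded_integrable_on _ _ _ mu _ mD muD _ H). Qed.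

Let ihS (S : set R) : measurable S -> mu.-integrable (D `&` S) (EFin \o h).
Proof.
move=> mS; apply: integrableS ih; [exact: mD| |exact: subIsetl].
exact: measurableI.
Qed.

Let mES (S : set R) : measurable S -> measurable (E `&` Y @^-1` S).
Proof. exact: mY. Qed.

Let P_initial_segment c :
  P (E `&` Y @^-1` `]-oo, c[%classic) = (\int[mu]_(z in D `&` `]-oo, c[) (h z)%:E)%E.
Proof.
(* Both sides live on $(0,1)$, so truncating [c] to $[0,1]$ changes neither. *)
wlog c01 : c / 0 <= c <= 1 => [wl|].
  have -> : E `&` Y @^-1` `]-oo, c[%classic =
      E `&` Y @^-1` `]-oo, Num.max 0 (Num.min c 1)[%classic.
    apply/seteqP; split => w /= [Ew]; rewrite !in_itv/= => Yc; split => //;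
      have /andP[Y0 Y1] := Y01 Ew.
      by rewrite lt_max lt_min Yc Y1 orbT.
    by move: Yc; rewrite lt_max lt_min => /orP[|/andP[]//]; rewrite ltNge ltW.
  have -> : D `&` `]-oo, c[%classic = D `&` `]-oo, Num.max 0 (Num.min c 1)[%classic.
    apply/seteqP; split => z /=; rewrite !in_itv/= => -[/andP[z0 z1] zc]; rewrite z0 z1;
      split => //.
      by rewrite lt_max lt_min zc z1 orbT.
    by move: zc; rewrite lt_max lt_min => /orP[|/andP[]//]; rewrite ltNge ltW.
  by apply: wl; rewrite le_max lexx/= ge_max ler01 ge_min lexx orbT.
have mI : measurable (`]-oo, c[%classic : set R) by exact: measurable_itv.
have := initial_segment_moment c01.
have -> : \int[P]_(w in E) ((Y w < c)%R%:R : R) = fine (P (E `&` Y @^-1` `]-oo, c[%classic)).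
  rewrite -[RHS]mul1r -(Rintegral_cst _ (mES mI)) Rintegral_mkcondr.
  apply: eq_Rintegral => w _; rewrite patchE; case: ifPn; rewrite ?notin_setE ?inE /= in_itv/=.
    by move=> ->.
  by move=> /negP/negPf ->.
have -> : \int[mu]_(z in D) ((z < c)%R%:R * h z) =
    \int[mu]_(z in D `&` `]-oo, c[) h z.
  rewrite Rintegral_mkcondr; apply: eq_Rintegral => z _.
  rewrite patchE; case: ifPn; rewrite ?notin_setE ?inE /= in_itv/=.
    by move=> ->; rewrite mul1r.
  by move=> /negP/negPf ->; rewrite mul0r.
have f1 : (\int[mu]_(z in D `&` `]-oo, c[) (h z)%:E)%E \is a fin_num.
  by apply: integrable_fin_num; [exact: measurableI|exact: ihS].
have f2 : P (E `&` Y @^-1` `]-oo, c[%classic) \is a fin_num.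
  by rewrite fin_num_measure//; exact: mES.
by move=> PhE; have := congr1 EFin PhE; rewrite /Rintegral (fineK f1) (fineK f2).
Qed.

(** Dynkin induction from the open rays. As [h] may change sign, complements subtract finite
    integrals and countable unions use integrability of [h]. *)
Lemma moment_law (B : set R) : measurable B ->
  P (E `&` Y @^-1` B) = (\int[mu]_(z in D `&` B) (h z)%:E)%E.
Proof.
move=> mB.
have ES1 : P E = (\int[mu]_(z in D) (h z)%:E)%E.
  have := P_initial_segment 1.
  rewrite (_ : E `&` _ = E); last first.
    apply/seteqP; split=> [w []//|w Ew]; split => //=.
    by rewrite in_itv/=; case/andP: (Y01 Ew).
  rewrite (_ : D `&` _ = D)//.
  apply/seteqP; split=> [z []//|z Dz]; split => //.
  by move: Dz; rewrite /= !in_itv/= => /andP[].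
apply: (@dynkin_induction _ (measurableTypeR R) (@RGenInftyO.G R)
  [set B | P (E `&` Y @^-1` B) = (\int[mu]_(z in D `&` B) (h z)%:E)%E]).
- exact: RGenInftyO.measurableE.
- move=> _ _ [x ->] [y ->]; exists (Num.min x y).
  by apply/seteqP; split => z /=; rewrite !in_itv/= lt_min => /andP.
- by rewrite /= preimage_setT !setIT.
- by move=> _ [x ->]; exact: P_initial_segment.
- move=> S mS /= PS.
  have mnS : measurable (~` S : set R) by exact: measurableC.
  have e1 : P E = (P (E `&` Y @^-1` S) + P (E `&` Y @^-1` (~` S)))%E.
    rewrite -measureU; [|exact: mES|exact: mES|].
      by rewrite -setIUr -preimage_setU setUv preimage_setT setIT.
    by apply/seteqP; split => w // [[_ Sw] [_ nSw]]; exact: nSw.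
  have e2 : (\int[mu]_(z in D) (h z)%:E =
      \int[mu]_(z in D `&` S) (h z)%:E + \int[mu]_(z in D `&` ~` S) (h z)%:E)%E.
    rewrite -integral_setU_EFin//.
    - by rewrite -setIUr setUv setIT.
    - exact: measurableI.
    - exact: measurableI.
    - by rewrite -setIUr setUv setIT.
    - by apply/disj_setPS => z [[_ Sz] [_ nSz]]; exact: nSz.
  have f1 : (\int[mu]_(z in D `&` S) (h z)%:E)%E \is a fin_num.
    by apply: integrable_fin_num; [exact: measurableI|exact: ihS].
  move: ES1; rewrite e1 e2 PS => e12.
  rewrite -[LHS](addeK _ f1) -[RHS](addeK _ f1).
  by congr (_ - _)%E; rewrite addeC e12 addeC.
- move=> F mF tF /= HF.
  rewrite preimage_bigcup setI_bigcupr setI_bigcupr.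
  rewrite measure_bigcup//; last 2 first.
  + by move=> i _; exact: (mES (mF i)).
  + apply/trivIsetP => i j _ _ ij; move/trivIsetP : tF => /(_ i j I I ij) FE.
    by apply/seteqP; split => w // [[_ Fi] [_ Fj]]; have : (F i `&` F j) (Y w) by []; rewrite FE.
  rewrite integral_bigcup.
  + rewrite (eq_eseriesl (Q := xpredT)); last by move=> i; rewrite in_setT.
    by apply: eq_eseriesr => i _; exact: HF.
  + apply/trivIsetP => i j _ _ ij; move/trivIsetP : tF => /(_ i j I I ij) FE.
    by apply/seteqP; split => z // [[_ Fi] [_ Fj]]; have : (F i `&` F j) z by []; rewrite FE.
  + by move=> i; apply: measurableI; [exact: mD|exact: mF].
  + rewrite (_ : \bigcup_k _ = D `&` \bigcup_k F k); last by rewrite setI_bigcupr.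
    by apply: ihS; apply: bigcup_measurable => k _; exact: mF.
- have : (@ocitv R).-sigma.-measurable B := mB.
  by rewrite RGenInftyO.measurableE.
Qed.

End moments.

(** * The sine series of the density *)

Section sine_series.
Variable R : realType.
Local Notation mu := (@lebesgue_measure R).
Local Notation D := (`]0, 1[%classic : set (measurableTypeR R)).
Implicit Types (k z : R) (n m : nat).

Lemma integral_cos_natpi k : k != 0 -> sin (k * pi) = 0 ->
  \int[mu]_(z in D) cos (k * pi * (1 - z)) = 0.
Proof.
move=> k0 sk; have pi0 : pi != 0 :> R by rewrite gt_eqF// pi_gt0.
pose F z := - sin (k * pi * (1 - z)) / (k * pi).
have dF z : is_derive z (1 : R) F (cos (k * pi * (1 - z))).
  rewrite /F; apply: is_derive_eq.
  by rewrite /GRing.scale/=; move: (pi : R) pi0 => pie pie0; field; rewrite pie0 k0.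
have cF : continuous F.
  by move=> z; apply/differentiable_continuous/derivable1_diffP; exact: ex_derive.
have cc : continuous (fun z => cos (k * pi * (1 - z))).
  move=> z; apply: (continuous_comp (f := fun z => k * pi * (1 - z)));
    last exact: continuous_cos.
  apply: cvgM; first exact: cvg_cst.
  by apply: cvgB; [exact: cvg_cst|exact: cvg_id].
have := @continuous_FTC2 R (fun z => cos (k * pi * (1 - z))) F 0 1 ltr01.
move=> /(_ (continuous_subspaceT cc)) FTC.
rewrite /Rintegral integral_itv_obnd_cbnd; last first.
  apply/measurable_EFinP; apply: measurable_funTS.
  exact: continuous_measurable_fun.
rewrite integral_itv_bndo_bndc; last first.
  apply/measurable_EFinP; apply: measurable_funTS.
  exact: continuous_measurable_fun.
rewrite FTC.
- by rewrite /F subrr mulr0 sin0 subr0 mulr1 sk oppr0 mul0r subee.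
- split.
  + by move=> z _; case: (dF z).
  + exact/cvg_at_right_filter/cF.
  + exact/cvg_at_left_filter/cF.
- by move=> z _; rewrite derive1E; case: (dF z).
Qed.

Lemma sine_orthogonal n m : (0 < n)%N -> (0 < m)%N ->
  \int[mu]_(z in D) (sin (n%:R * pi * (1 - z)) * sin (m%:R * pi * (1 - z))) =
  (n == m)%:R / 2.
Proof.
move=> n0 m0.
have mD : measurable D by exact: measurable_itv.
have muD : (mu D < +oo)%E by rewrite /= lebesgue_measure_itv/= lte_fin ltr01 -EFinB ltry.
have ic k : mu.-integrable D (EFin \o (fun z => cos (k * pi * (1 - z)))).
  apply: (@bounded_integrable_on _ _ _ mu _ mD muD _ 1).
    apply: measurable_funTS; apply: (measurableT_comp (f := cos)).
      exact: (continuous_measurable_fun (@continuous_cos R)).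
    by apply: measurable_funM => //; apply: measurable_funB.
  by move=> z _; exact: cos_max.
have E z : sin (n%:R * pi * (1 - z)) * sin (m%:R * pi * (1 - z)) =
    2^-1 * (cos ((n%:R - m%:R) * pi * (1 - z)) - cos ((n%:R + m%:R) * pi * (1 - z))).
  by rewrite !mulrBl !mulrDl cosB cosD; field.
under eq_Rintegral do rewrite E.
rewrite RintegralZl//; last by have := integrableB mD (ic (n%:R - m%:R)) (ic (n%:R + m%:R)).
rewrite RintegralB// [X in _ - X]integral_cos_natpi; last 2 first.
- by rewrite -natrD pnatr_eq0 -lt0n addn_gt0 n0.
- by rewrite -natrD sin_natpi.
have [->|nm] := eqVneq n m.
  under eq_Rintegral do rewrite subrr !mul0r cos0.
  rewrite Rintegral_cst//= lebesgue_measure_itv/= lte_fin ltr01 -EFinB/=.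
  by rewrite !subr0 mulr1 mul1r mulr1.
rewrite integral_cos_natpi ?subrr ?mulr0 ?mul0r//.
- by rewrite subr_eq0 eqr_nat.
- by rewrite mulrBl sinB !sin_natpi mul0r mulr0 subrr.
Qed.

Variables (c : nat -> R) (a q : R).
Hypotheses (q0 : 0 <= q) (q1 : q < 1) (ca : forall n, `|c n| <= a * q ^+ n).

Let term z n := c n * sin (n%:R * pi * (1 - z)).

Definition sine_series z : R := limn (series (term z)).

Let term_le z n : `|term z n| <= geometric a q n.
Proof.
by rewrite /term normrM /geometric/= -[leRHS]mulr1 ler_pM// sin_max.
Qed.

Let a0 : 0 <= a.
Proof. by have := le_trans (normr_ge0 _) (ca 0); rewrite expr0 mulr1. Qed.

Lemma sine_series_cvg z : series (term z) n @[n --> \oo] --> sine_series z.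
Proof.
have : cvgn [normed series (term z)].
  have g0 n : 0 <= geometric a q n by exact: le_trans (term_le z n).
  apply: (series_le_cvg (fun n => normr_ge0 _) g0 (term_le z)).
  by apply: is_cvg_geometric_series; rewrite ger0_norm.
by move=> /normed_cvg.
Qed.

Lemma sine_series_partial_le z n : `|series (term z) n| <= a / (1 - q).
Proof.
rewrite /series/= (le_trans (ler_norm_sum _ _ _))//.
apply: (@le_trans _ _ (series (geometric a q) n)).
  by apply: ler_sum => i _; exact: term_le.
rewrite geometric_seriesE ?lt_eqF//= ler_wpM2r ?invr_ge0 ?subr_ge0 ?(ltW q1)//.
by rewrite ler_piMr// gerBl exprn_ge0.
Qed.

Lemma sine_series_le z : `|sine_series z| <= a / (1 - q).
Proof.
apply: (ler_cvg_to (cvg_norm (@sine_series_cvg z)) (cvg_cst _)).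
by apply: nearW => n; exact: sine_series_partial_le.
Qed.

Let msin n : measurable_fun setT (fun z : R => sin (n%:R * pi * (1 - z))).
Proof. by apply: measurable_sine_sum; constructor. Qed.

Let mterm n : measurable_fun setT (fun z => term z n).
Proof. by apply: measurable_funM. Qed.

Let mpartial n : measurable_fun setT (fun z => series (term z) n).
Proof.
by apply: measurable_sum => i; exact: mterm.
Qed.

Lemma measurable_sine_series : measurable_fun setT sine_series.
Proof.
by apply: (measurable_fun_cvg mpartial) => z _; exact: sine_series_cvg.
Qed.

(** By orthogonality the moment of a partial sum is constant once it includes index m; the uniform
    bound on partial sums allows the passage to the limit. *)
Lemma sine_series_moment m : (0 < m)%N ->
  \int[mu]_(z in D) (sin (m%:R * pi * (1 - z)) * sine_series z) = c m / 2.
Proof.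
move=> m0.
have mD : measurable D by exact: measurable_itv.
have muD : (mu D < +oo)%E by rewrite /= lebesgue_measure_itv/= lte_fin ltr01 -EFinB ltry.
have iprod i : mu.-integrable D
    (EFin \o (fun z => sin (m%:R * pi * (1 - z)) * term z i)).
  apply: (@bounded_integrable_on _ _ _ mu _ mD muD _ (1 * (`|c i| * 1))).
    exact: (measurable_funTS (measurable_funM (msin m) (mterm i))).
  move=> z _; rewrite normrM ler_pM ?sin_max//.
  by rewrite normrM ler_pM ?sin_max.
have c0 : forall i, \int[mu]_(z in D) (sin (m%:R * pi * (1 - z)) * term z i) =
    if i == m then c m / 2 else 0.
  move=> i; rewrite /term.
  have [->|i0] := posnP i.
    rewrite (ltn_eqF m0); under eq_Rintegral do rewrite mul0r mul0r sin0 !mulr0.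
    by rewrite Rintegral_cst// mul0r.
  under eq_Rintegral do rewrite mulrCA.
  rewrite RintegralZl//; last first.
    apply: (@bounded_integrable_on _ _ _ mu _ mD muD _ (1 * 1)).
      exact: (measurable_funTS (measurable_funM (msin m) (msin i))).
    by move=> z _; rewrite normrM ler_pM ?sin_max.
  rewrite sine_orthogonal// (eq_sym m i); case: eqP => [->|_].
    by rewrite mul1r.
  by rewrite mul0r mulr0.
have psum n : \int[mu]_(z in D) (sin (m%:R * pi * (1 - z)) * series (term z) n) =
    (if (m < n)%N then c m / 2 else 0) /\
    mu.-integrable D (EFin \o (fun z => sin (m%:R * pi * (1 - z)) * series (term z) n)).
  elim: n => [|n [IH1 IH2]].
    split.
      under eq_Rintegral do rewrite /series/= big_geq// mulr0.
      by rewrite Rintegral_cst// mul0r.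
    apply: (@bounded_integrable_on _ _ _ mu _ mD muD _ 0).
      exact: (measurable_funTS (measurable_funM (msin m) (mpartial 0))).
    by move=> z _; rewrite /series/= big_geq// mulr0 normr0.
  have e z : sin (m%:R * pi * (1 - z)) * series (term z) n.+1 =
      sin (m%:R * pi * (1 - z)) * series (term z) n +
      sin (m%:R * pi * (1 - z)) * term z n.
    by rewrite /series/= big_nat_recr//= mulrDr.
  rewrite (_ : (fun z => sin (m%:R * pi * (1 - z)) * series (term z) n.+1) =
    (fun z => sin (m%:R * pi * (1 - z)) * series (term z) n +
      sin (m%:R * pi * (1 - z)) * term z n)); last by apply/funext => z; exact: e.
  split; last exact: (integrableD mD IH2 (iprod n)).
  rewrite RintegralD// IH1 c0 ltnS.
  by case: (ltngtP m n) => [_|_|->]; rewrite ?addr0 ?add0r.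
have lim1 : \int[mu]_(z in D) (sin (m%:R * pi * (1 - z)) * series (term z) n) @[n --> \oo]
    --> \int[mu]_(z in D) (sin (m%:R * pi * (1 - z)) * sine_series z).
  apply: (@bounded_cvg_Rintegral _ _ _ mu _ mD muD _ _ (1 * (a / (1 - q)))).
  - by move=> n; exact: (measurable_funTS (measurable_funM (msin m) (mpartial n))).
  - by move=> n z _; rewrite normrM ler_pM// ?sin_max// sine_series_partial_le.
  - by move=> z _; apply: cvgM; [exact: cvg_cst|exact: sine_series_cvg].
have lim2 : \int[mu]_(z in D) (sin (m%:R * pi * (1 - z)) * series (term z) n) @[n --> \oo]
    --> c m / 2.
  by apply: cvg_near_cst; exists m.+1 => // n /= mn; rewrite (psum n).1 mn.
exact: (cvg_unique _ lim1 lim2).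
Qed.

End sine_series.

Section kernel_series.
Variable R : realType.
Implicit Types (p : R * R) (n : nat).

(* At n = 0 the quotient is 2 / 0 = 0, so the term outside the range of the
   sum over n >= 1 vanishes. *)
Definition kernel_coef p n : R := 2 / sinh (n%:R * pi) * bracket (n%:R * pi) p.

Lemma sinh_natpi_ge n : (0 < n)%N -> expR (n%:R * pi) / 4 <= sinh (n%:R * pi) :> R.
Proof.
move=> n0; have np : 1 <= n%:R * pi :> R.
  have p1 : 1 <= pi :> R by apply: le_trans (pi_ge2 R); rewrite ler1n.
  by rewrite -[leLHS]mul1r ler_pM// ler1n.
have e1 := expR_ge1Dx (n%:R * pi : R).
have e2 : expR (- (n%:R * pi)) <= 1 :> R by rewrite expR_le1; lra.
rewrite /sinh; lra.
Qed.

Lemma sinh_natpi_gt0 n : (0 < n)%N -> 0 < sinh (n%:R * pi) :> R.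
Proof.
by move=> n0; apply: lt_le_trans (sinh_natpi_ge n0); rewrite divr_gt0 ?expR_gt0.
Qed.

(** Let M be the largest of $x, 1-x, y, 1-y$; it is below 1 because the point is off the diagonal.
    Each of four terms is at most $e^{n\pi M}$ and $\sinh(n\pi) \ge e^{n\pi}/4$, whence the ratio
    $e^{-\pi(1-M)}$ and $32 = 2 \cdot 4 \cdot 4$. *)
Lemma kernel_coef_le p : triangle p -> p.2 < p.1 -> exists q : R,
  [/\ 0 <= q, q < 1 & forall n, `|kernel_coef p n| <= 32 * q ^+ n].
Proof.
case: p => u v [/= v0 u1 vu] lt_vu.
set x := (u + v) / 2; set y := (u - v) / 2.
pose M := Num.max (Num.max x (1 - x)) (Num.max y (1 - y)).
have M1 : M < 1 by rewrite /M !gt_max /x /y; apply/andP; split; apply/andP; split; lra.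
have M0 : 0 <= M by rewrite /M !le_max /y; apply/orP; right; apply/orP; left; lra.
exists (expR (- (pi * (1 - M)))); split; first exact: expR_ge0.
  by rewrite expR_lt1 oppr_lt0 mulr_gt0 ?pi_gt0// subr_gt0.
move=> n; rewrite -expRM_natl.
have [->|n0] := posnP n.
  by rewrite /kernel_coef !mul0r sinh0 invr0 mulr0 mul0r normr0 expR0 mulr1.
set k := n%:R * pi : R.
have k0 : 0 <= k by rewrite /k mulr_ge0// pi_ge0.
have sc X Y : 0 <= Y <= M -> `|sin_clamp_sinh k X Y| <= expR (k * M).
  move=> /andP[Y0 YM]; rewrite sin_clamp_sinhE//; last first.
    by rewrite Y0 (le_trans YM)// ltW.
  rewrite normrM -[leRHS]mul1r ler_pM ?sin_max//.
  have kY : `|k * Y| <= k * M by rewrite (ger0_norm (mulr_ge0 k0 Y0)); exact: ler_wpM2l.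
  exact: (sinh_cosh_norm_le kY).1.
have le4 : `|bracket k (u, v)| <= 4 * expR (k * M).
  rewrite /bracket/= -/x -/y.
  have h1 := @sc x y; have h2 := @sc (1 - x) (1 - y).
  have h3 := @sc y x; have h4 := @sc (1 - y) (1 - x).
  have bx : x <= M by rewrite /M !le_max lexx.
  have bx' : 1 - x <= M by rewrite /M !le_max lexx !orbT.
  have by_ : y <= M by rewrite /M !le_max lexx !orbT.
  have by' : 1 - y <= M by rewrite /M !le_max lexx !orbT.
  have {}h1 : `|sin_clamp_sinh k x y| <= expR (k * M).
    by apply: h1; rewrite by_ andbT /y; lra.
  have {}h2 : `|sin_clamp_sinh k (1 - x) (1 - y)| <= expR (k * M).
    by apply: h2; rewrite by' andbT /y; lra.
  have {}h3 : `|sin_clamp_sinh k y x| <= expR (k * M).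
    by apply: h3; rewrite bx andbT /x; lra.
  have {}h4 : `|sin_clamp_sinh k (1 - y) (1 - x)| <= expR (k * M).
    by apply: h4; rewrite bx' andbT /x; lra.
  move: h1 h2 h3 h4; rewrite !ler_norml.
  move=> /andP[? ?] /andP[? ?] /andP[? ?] /andP[? ?].
  by apply/andP; split; lra.
have sg := sinh_natpi_ge n0; rewrite -/k in sg.
have s0 := sinh_natpi_gt0 n0; rewrite -/k in s0.
have d0 : 0 <= 2 / sinh k by apply: divr_ge0 => //; exact: ltW.
rewrite /kernel_coef -/k normrM (ger0_norm d0).
rewrite mulrAC ler_pdivrMr//.
have eE : expR (n%:R * - (pi * (1 - M))) * expR k = expR (k * M).
  by rewrite -expRD; congr expR; rewrite /k; ring.
have e0 := expR_ge0 (n%:R * - (pi * (1 - M)) : R).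
rewrite -eE in le4.
have := ler_wpM2l e0 sg; lra.
Qed.

Lemma h_fun_series p z : triangle p ->
  h_fun ((p.1 + p.2) / 2) ((p.1 - p.2) / 2) z = sine_series (kernel_coef p) z.
Proof.
case: p => u v [/= v0 u1 vu]; rewrite /h_fun /sine_series.
set x := (u + v) / 2; set y := (u - v) / 2.
have x01 : 0 <= x <= 1 by rewrite /x; apply/andP; split; lra.
have y01 : 0 <= y <= 1 by rewrite /y; apply/andP; split; lra.
have x01' : 0 <= 1 - x <= 1 by apply/andP; split; lra.
have y01' : 0 <= 1 - y <= 1 by apply/andP; split; lra.
have E n : h_term x y z n = kernel_coef (u, v) n * sin (n%:R * pi * (1 - z)).
  have k0 : 0 <= n%:R * pi :> R by rewrite mulr_ge0// pi_ge0.
  rewrite /h_term /kernel_coef /bracket/= -/x -/y !sin_clamp_sinhE// /s_fun.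
  by rewrite -!mulrA; congr (_ * _); rewrite mulrCA; congr (_ * _); rewrite mulrC.
congr (limn _); apply/funext => N; rewrite /series/=.
(* [h_fun] sums from 1 and [series] from 0; the extra term is 0. *)
case: N => [|N]; first by rewrite !big_geq.
rewrite [RHS]big_ltn// /kernel_coef !mul0r sinh0 invr0 mulr0 !mul0r add0r.
by apply: eq_bigr => n _; rewrite E.
Qed.

End kernel_series.

(** * The harmonic measure formula *)

Theorem theorem8p1 (R : realType) (d : measure_display)
    (Omega : measurableType d) (P : probability Omega R)
    (u v : R) (W : R -> Omega -> R * R) (B : set R) :
  (sq_lower R `\` sq_diag R) (u, v) ->
  brownian_motion P (u, v) W ->
  measurable B -> B `<=` `[0, 1] ->
  diag_hit_prob P W B =
  (\int[lebesgue_measure]_(w in B)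
      (h_fun ((u + v) / 2) ((u - v) / 2) w)%:E)%E.
Proof.
move=> [[[]]] /=; rewrite !in_itv/= => /andP[u0 u1] /andP[v0 v1] vu nd bm mB B01.
have tp : triangle (u, v) by split.
have lt_vu : v < u.
  rewrite lt_neqAle vu andbT; apply/eqP => uv; apply: nd.
  by split => //; split; rewrite /= in_itv/= ?u0 ?v0.
have [q [q0 q1 cq]] := kernel_coef_le tp lt_vu.
pose h := sine_series (kernel_coef (u, v)).
have mh : measurable_fun setT h := measurable_sine_series q0 q1 cq.
have hb := sine_series_le q0 q1 cq.
rewrite (diag_hit_probE bm tp).
rewrite (@moment_law _ _ _ P (exits_diag W) (fun w => (exit_pt W w).1) h (32 / (1 - q)))//.
- have mD : measurable (`]0, 1[%classic : set (measurableTypeR R)) by exact: measurable_itv.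
  under [RHS]eq_integral do rewrite (h_fun_series _ tp).
  pose ends : set (measurableTypeR R) := [set (0 : R); (1 : R)].
  (* The law was identified on the open interval; [B] may also contain the endpoints 0 and 1, a null
     set. *)
  rewrite [RHS](@negligible_integral _ _ _ _ _ ends)//.
  + congr integral.
    apply/seteqP; split => z /=; rewrite in_itv/=.
      move=> [/andP[z0 z1] Bz]; split => // -[] zE.
        by rewrite zE ltxx in z0.
      by rewrite zE ltxx in z1.
    move=> [Bz nz]; split => //; have := B01 _ Bz; rewrite /= in_itv/= => /andP[z0 z1].
    rewrite !lt_neqAle z0 z1 !andbT; apply/andP; split; apply/eqP => zE; apply: nz.
      by left.
    by right.
  + by apply: measurableU; exact: measurable_set1.
  + apply: (@bounded_integrable_on _ _ _ lebesgue_measure B mB _ _ (32 / (1 - q))).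
    * apply: (@le_lt_trans _ _ (lebesgue_measure (`[0, 1]%classic : set R))).
        by apply: le_measure; rewrite ?inE//; exact: measurable_itv.
      by rewrite /= lebesgue_measure_itv/= lte_fin ltr01 -EFinB ltry.
    * exact: measurable_funTS.
    * by move=> z _; exact: hb.
  + apply: countable_lebesgue_measure0; apply: finite_set_countable.
    by rewrite finite_setU; split; exact: finite_set1.
- exact: (measurable_exits_diagT bm tp).
- exact: (measurable_exit_pt1_diag bm tp).
- by move=> w [_ []].
- exact: measurable_funTS.
- move=> n n0; rewrite (sine_series_moment q0 q1 cq n0).
  have s0 := @sinh_natpi_gt0 R n n0.
  apply: (mulIf (lt0r_neq0 s0)); rewrite (exits_diag_mean bm tp n0) /kernel_coef.
  by field; rewrite lt0r_neq0.
Qed.
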